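(* The $\mathrm{Cl}(\mathbb{R}^{1,n-1},e)$-points of $\mathcal{B}_1(P_4)$ which send $x_{12}$ and $x_{34}$ to $1$ parameterize an open subset of the group $\mathrm{Spin}(2,n)$, while the positive such points parameterize the $\Theta$-positive semigroup $\mathrm{Spin}(2,n)^{>0}$.
   Context: The algebra $\mathcal{B}_1(P_n)$. Let $P_n$ be the $n$-gon with vertices labeled cyclically $1,\dots,n$. $\mathcal{D}_2(P_n)$ is the $\mathbb{Q}$-algebra generated by $x_{ij}^{\pm1},y_{ij}^{\pm1}$ for $i\ne j\in\{1,\dots,n\}$ subject to the triangle relations $x_{kj}^{-1}x_{ki}x_{ji}^{-1}=x_{ij}^{-1}x_{ik}x_{jk}^{-1}$ for all distinct $i,j,k$ and the exchange relations $x_{\ell j}=x_{\ell k}x_{ik}^{-1}x_{ij}+x_{\ell i}x_{ki}^{-1}x_{kj}$ for all cyclically ordered $(i,j,k,\ell)$, and the same relations with $y$ in place of $x$. $\mathcal{B}_1(P_n)$ is obtained from $\mathcal{D}_2(P_n)$ by imposing, for every $i\neq j$, $x_{ij}y_{ji}=y_{ij}x_{ji}$ and that $x_{ij}y_{ji}$ is central, and localizing by the center. It has commuting anti-involutions $\sigma$: $x_{ij}\mapsto x_{ji}$, $y_{ij}\mapsto y_{ji}$, and $\tau$: $x_{ij}\mapsto y_{ji}$, $y_{ij}\mapsto x_{ji}$. The canonical angle of the triangle $ijk$ at $j$ is $\Delta_j^{ki}=y_{jk}x_{ki}y_{ij}$. Clifford algebras. $V=\mathbb{R}^{1,n-1}$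 is an $n$-dimensional real vector space with quadratic form $q$ of signature $(1,n-1)$; $\mathrm{Cl}(\mathbb{R}^{1,n-1})$ is the unital algebra generated by $V$ with $v^2=q(v)$; $x\mapsto x^T$ is the anti-involution reversing products of vectors; $\alpha$ is the grading automorphism, $\alpha(v)=-v$; the Clifford group $\Gamma$ is the group of units $x$ with $\alpha(x)vx^{-1}\in V$ for all $v\in V$; the norm of $x\in\Gamma$ is $xx^T\in\mathbb{R}^\times$. Fix $e\in V$ with $q(e)=1$; $\tau(x)=x^T$, $\sigma_e(x)=e\,x^Te$, $eV=\{ev:v\in V\}$, and $V^+$ is the cone of vectors of positive norm containing $e$. A $\mathrm{Cl}(\mathbb{R}^{1,n-1},e)$-point of $\mathcal{B}_1(P_m)$ is an algebra homomorphism $\phi:\mathcal{B}_1(P_m)\to\mathrm{Cl}(\mathbb{R}^{1,n-1})$ intertwining the anti-involutions ($\sigma$ with $\sigma_e$, $\tau$ with $\tau$), with $\phi(x_{ij})\in\Gamma$ for all arcs and $\phi(\Delta_j^{ik})\in eV$ for all angles. It is positive if all angles are mapped into $eV^+$ and all arcs to elements of $\Gamma$ with positive real norm. The group and the parameterization. $\mathrm{Spin}(2,n)$ is realized by $2\times2$ matrices over $\mathrm{Cl}(\mathbb{R}^{1,n-1})$ (inside the group $\mathrm{Sp}_2(\mathrm{Cl}(\mathbb{R}^{1,n-1}),\sigma_e)$ of matrices preserving the standard $\sigma_e$-sesquilinear skew form), and generic elements factor as $$\begin{pmatrix} 1 & 0 \\ y & 1 \end{pmatrix}\begin{pmatrix}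 x & 0 \\ 0 & \sigma_e(x)^{-1} \end{pmatrix}\begin{pmatrix} 1 & z \\ 0 & 1 \end{pmatrix},\qquad x,y,z\in\Gamma,\ \sigma_e(y)=y,\ \sigma_e(z)=z;$$ a point $\phi$ with $\phi(x_{12})=\phi(x_{34})=1$ corresponds to $x=\phi(x_{13})$, $xz=\phi(x_{14})$, $yx=\phi(x_{23})$. $\Theta$-positive semigroup (Guichard–Wienhard). Let $P_\Theta$ be the maximal parabolic subgroup of $\mathrm{Spin}(2,n)$ stabilizing an isotropic line, with Levi factor $L_\Theta$ and abelian unipotent radical $U_\Theta\cong\mathbb{R}^{1,n-1}$, and let $U_\Theta^{\mathrm{opp}}$ be the opposite unipotent radical. Let $U_\Theta^{>0}$, $U_\Theta^{\mathrm{opp},>0}$ be the images of the ($L_\Theta^\circ$-invariant) open cones corresponding to $V^+$. $\mathrm{Spin}(2,n)^{>0}$ is the subsemigroup generated by $U_\Theta^{>0}$, $U_\Theta^{\mathrm{opp},>0}$ and the identity component $L_\Theta^\circ$.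
   Formalization: Points are restricted to those with even arcs (odd ones, e.g. x_13 ↦ e, have matrices outside Spin(2,n)); Spin(2,n)^{>0} is the products in which both U^{>0} and U^{opp,>0} occur (else it contains 1); the positive claim is for n ≥ 3 (it fails for n = 1, 2). *)

(* Defs.v *)
From HB Require Import structures.
From mathcomp Require Import all_boot all_order all_algebra.
From mathcomp Require Import all_classical all_reals all_analysis.
From mathcomp Require Import ring.

Set Implicit Arguments.
Unset Strict Implicit.
Unset Printing Implicit Defensive.

Import Order.TTheory GRing.Theory Num.Theory.
Import numFieldNormedType.Exports.

Local Open Scope classical_set_scope.
Local Open Scope ring_scope.

Inductive pterm (G : Type) : Type :=
| PGen of G
| PCst of rat
| PAdd of pterm G & pterm G
| POpp of pterm G
| PMul of pterm G & pterm G.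
Arguments PCst {G}.

HB.instance Definition _ (G : Type) := gen_eqMixin (pterm G).
HB.instance Definition _ (G : Type) := gen_choiceMixin (pterm G).

(* The congruence generated by the axioms of (unital, associative) algebras
   over rat and by the relations in rel. *)
Inductive pcong (G : Type) (rel : pterm G -> pterm G -> Prop) :
  pterm G -> pterm G -> Prop :=
| pcong_rel s t : rel s t -> pcong rel s t
| pcong_refl t : pcong rel t t
| pcong_sym s t : pcong rel s t -> pcong rel t s
| pcong_trans t s u : pcong rel s t -> pcong rel t u -> pcong rel s u
| pcong_add s s' t t' : pcong rel s s' -> pcong rel t t' ->
    pcong rel (PAdd s t) (PAdd s' t')
| pcong_opp s s' : pcong rel s s' -> pcong rel (POpp s) (POpp s')
| pcong_mul s s' t t' : pcong rel s s' -> pcong rel t t' ->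
    pcong rel (PMul s t) (PMul s' t')
| pcong_addA s t u : pcong rel (PAdd s (PAdd t u)) (PAdd (PAdd s t) u)
| pcong_addC s t : pcong rel (PAdd s t) (PAdd t s)
| pcong_add0 t : pcong rel (PAdd (PCst 0) t) t
| pcong_addN t : pcong rel (PAdd (POpp t) t) (PCst 0)
| pcong_mulA s t u : pcong rel (PMul s (PMul t u)) (PMul (PMul s t) u)
| pcong_mul1l t : pcong rel (PMul (PCst 1) t) t
| pcong_mul1r t : pcong rel (PMul t (PCst 1)) t
| pcong_mulDl s t u :
    pcong rel (PMul (PAdd s t) u) (PAdd (PMul s u) (PMul t u))
| pcong_mulDr s t u :
    pcong rel (PMul s (PAdd t u)) (PAdd (PMul s t) (PMul s u))
| pcong_cstD (a b : rat) : pcong rel (PCst (a + b)) (PAdd (PCst a) (PCst b))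
| pcong_cstM (a b : rat) : pcong rel (PCst (a * b)) (PMul (PCst a) (PCst b))
| pcong_cstC (a : rat) t : pcong rel (PMul (PCst a) t) (PMul t (PCst a)).

Section Presented.
Variables (G : Type) (rl : pterm G -> pterm G -> Prop).

Definition pequiv : rel (pterm G) := fun s t => `[< pcong rl s t >].

Lemma pequiv_class : equiv_class_of pequiv.
Proof.
split=> [t | s t | t s u].
- exact/asboolP/pcong_refl.
- by apply/asboolP/asboolP; exact: pcong_sym.
- by move=> /asboolP st /asboolP tu; apply/asboolP/pcong_trans/tu.
Qed.

Canonical pequiv_equiv := EquivRelPack pequiv_class.

Definition presented : Type := {eq_quot pequiv_equiv}%qT.
HB.instance Definition _ := Choice.on presented.
HB.instance Definition _ := EqQuotient.on presented.

Definition pclass (t : pterm G) : presented := (\pi_presented t)%qT.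
Definition prepr (a : presented) : pterm G := repr a.

Lemma preprK a : pclass (prepr a) = a. Proof. exact: reprK. Qed.

Lemma pclassP s t : pclass s = pclass t <-> pcong rl s t.
Proof.
split=> [/eqP | st]; first by rewrite /pclass eqquotE => /asboolP.
by apply/eqP; rewrite /pclass eqquotE; apply/asboolP.
Qed.

Lemma prepr_class t : pcong rl (prepr (pclass t)) t.
Proof. by apply/pclassP; rewrite preprK. Qed.

Let p0 := pclass (PCst 0).
Let p1 := pclass (PCst 1).
Let padd a b := pclass (PAdd (prepr a) (prepr b)).
Let popp a := pclass (POpp (prepr a)).
Let pmul a b := pclass (PMul (prepr a) (prepr b)).

Let paddE s t : padd (pclass s) (pclass t) = pclass (PAdd s t).
Proof. by apply/pclassP/pcong_add; exact: prepr_class. Qed.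
Let poppE s : popp (pclass s) = pclass (POpp s).
Proof. by apply/pclassP/pcong_opp; exact: prepr_class. Qed.
Let pmulE s t : pmul (pclass s) (pclass t) = pclass (PMul s t).
Proof. by apply/pclassP/pcong_mul; exact: prepr_class. Qed.

Let paddA : associative padd.
Proof.
move=> a b c; rewrite -[a]preprK -[b]preprK -[c]preprK !paddE.
exact/pclassP/pcong_addA.
Qed.
Let paddC : commutative padd.
Proof.
by move=> a b; rewrite -[a]preprK -[b]preprK !paddE; exact/pclassP/pcong_addC.
Qed.
Let padd0 : left_id p0 padd.
Proof. by move=> a; rewrite -[a]preprK paddE; exact/pclassP/pcong_add0. Qed.
Let paddN : left_inverse p0 popp padd.
Proof.
by move=> a; rewrite -[a]preprK poppE paddE; exact/pclassP/pcong_addN.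
Qed.
Let pmulA : associative pmul.
Proof.
move=> a b c; rewrite -[a]preprK -[b]preprK -[c]preprK !pmulE.
exact/pclassP/pcong_mulA.
Qed.
Let pmul1l : left_id p1 pmul.
Proof. by move=> a; rewrite -[a]preprK pmulE; exact/pclassP/pcong_mul1l. Qed.
Let pmul1r : right_id p1 pmul.
Proof. by move=> a; rewrite -[a]preprK pmulE; exact/pclassP/pcong_mul1r. Qed.
Let pmulDl : left_distributive pmul padd.
Proof.
move=> a b c; rewrite -[a]preprK -[b]preprK -[c]preprK paddE !pmulE paddE.
exact/pclassP/pcong_mulDl.
Qed.
Let pmulDr : right_distributive pmul padd.
Proof.
move=> a b c; rewrite -[a]preprK -[b]preprK -[c]preprK paddE !pmulE paddE.
exact/pclassP/pcong_mulDr.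
Qed.

HB.instance Definition _ := GRing.isPzRing.Build presented
  paddA paddC padd0 paddN pmulA pmul1l pmul1r pmulDl pmulDr.

Lemma pclassD s t : pclass (PAdd s t) = pclass s + pclass t.
Proof. by rewrite -paddE. Qed.
Lemma pclassN s : pclass (POpp s) = - pclass s.
Proof. by rewrite -poppE. Qed.
Lemma pclassM s t : pclass (PMul s t) = pclass s * pclass t.
Proof. by rewrite -pmulE. Qed.
Lemma pclass0 : pclass (PCst 0) = 0. Proof. by []. Qed.
Lemma pclass1 : pclass (PCst 1) = 1. Proof. by []. Qed.

(* The anti-endomorphism of terms extending a map f of generators, and the
   map it induces on the presented algebra when it respects rl. *)
Fixpoint pterm_rev (f : G -> G) (t : pterm G) : pterm G :=
  match t with
  | PGen g => PGen (f g)
  | PCst a => PCst a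
  | PAdd s t => PAdd (pterm_rev f s) (pterm_rev f t)
  | POpp s => POpp (pterm_rev f s)
  | PMul s t => PMul (pterm_rev f t) (pterm_rev f s)
  end.

Definition pres_rev (f : G -> G) (a : presented) : presented :=
  pclass (pterm_rev f (prepr a)).

Lemma pcong_rev f s t :
  (forall s t, rl s t -> pcong rl (pterm_rev f s) (pterm_rev f t)) ->
  pcong rl s t -> pcong rl (pterm_rev f s) (pterm_rev f t).
Proof.
move=> frel; elim=> {s t} /=; first exact: frel.
- by move=> t; exact: pcong_refl.
- by move=> s t _; exact: pcong_sym.
- by move=> t s u _ st _; exact: pcong_trans.
- by move=> *; exact: pcong_add.
- by move=> *; exact: pcong_opp.
- by move=> *; exact: pcong_mul.
- by move=> *; exact: pcong_addA.
- by move=> *; exact: pcong_addC.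
- by move=> *; exact: pcong_add0.
- by move=> *; exact: pcong_addN.
- by move=> *; apply: pcong_sym; exact: pcong_mulA.
- by move=> *; exact: pcong_mul1r.
- by move=> *; exact: pcong_mul1l.
- by move=> *; exact: pcong_mulDr.
- by move=> *; exact: pcong_mulDl.
- by move=> *; exact: pcong_cstD.
- by move=> a b; rewrite mulrC; exact: pcong_cstM.
- by move=> *; apply: pcong_sym; exact: pcong_cstC.
Qed.

Section Rev.
Variable f : G -> G.
Hypothesis frel :
  forall s t, rl s t -> pcong rl (pterm_rev f s) (pterm_rev f t).

Lemma pres_rev_class t : pres_rev f (pclass t) = pclass (pterm_rev f t).
Proof. by apply/pclassP/pcong_rev/prepr_class. Qed.

Lemma pres_revD a b : pres_rev f (a + b) = pres_rev f a + pres_rev f b.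
Proof.
by rewrite -[a]preprK -[b]preprK -pclassD !pres_rev_class /= pclassD.
Qed.

Lemma pres_revM a b : pres_rev f (a * b) = pres_rev f b * pres_rev f a.
Proof.
by rewrite -[a]preprK -[b]preprK -pclassM !pres_rev_class /= pclassM.
Qed.

Lemma pres_rev1 : pres_rev f 1 = 1.
Proof. by rewrite -pclass1 pres_rev_class. Qed.
End Rev.

End Presented.

(* The vertices 1, ..., m of the polygon are the elements 0, ..., m - 1 of
   'I_m. *)
Definition arc (m : nat) : Type := {p : 'I_m * 'I_m | p.1 != p.2}.

Inductive letter : Type := LX | LY.

Definition swap_letter (l : letter) := if l is LX then LY else LX.

(* Gen l false (i, j) is x_ij or y_ij and Gen l true (i, j) its inverse. *)
Inductive gen (m : nat) : Type := Gen of letter & bool & arc m.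

Definition cyclic4 (m : nat) (i j k l : 'I_m) : bool :=
  let increasing (a b c d : 'I_m) := [&& a < b, b < c & c < d]%N in
  [|| increasing i j k l, increasing j k l i,
      increasing k l i j | increasing l i j k].

Section Polygon.
Variable m : nat.
Implicit Types i j k l : 'I_m.

(* The default value 0 is taken for i = j only, where no arc exists. *)
Definition gterm (c : letter) (inv : bool) i j : pterm (gen m) :=
  oapp (fun a : arc m => PGen (Gen c inv a)) (PCst 0) (insub (i, j)).

Local Notation "s ** t" := (PMul s t) (at level 40, left associativity).
Local Notation "s ++ t" := (PAdd s t).
Local Notation u c := (gterm c false).
Local Notation ui c := (gterm c true).

Inductive D2_rel : pterm (gen m) -> pterm (gen m) -> Prop :=
| D2_invl c i j : i != j -> D2_rel (ui c i j ** u c i j) (PCst 1)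
| D2_invr c i j : i != j -> D2_rel (u c i j ** ui c i j) (PCst 1)
| D2_triangle c i j k : i != j -> j != k -> k != i ->
    D2_rel (ui c k j ** u c k i ** ui c j i) (ui c i j ** u c i k ** ui c j k)
| D2_exchange c i j k l : cyclic4 i j k l ->
    D2_rel (u c l j)
      (u c l k ** ui c i k ** u c i j ++ u c l i ** ui c k i ** u c k j).

Inductive B1_rel : pterm (gen m) -> pterm (gen m) -> Prop :=
| B1_D2 s t : D2_rel s t -> B1_rel s t
| B1_norm i j : i != j ->
    B1_rel (u LX i j ** u LY j i) (u LY i j ** u LX j i)
| B1_central i j t : i != j ->
    B1_rel (u LX i j ** u LY j i ** t) (t ** (u LX i j ** u LY j i)).

(* The elements x_ij y_ji being products of units, the localization at these
   central elements is the algebra itself.  (Inverting every nonzero central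
   element is not meant: it would invert x_12 y_21 - 1, which every
   homomorphism normalized by x_12, y_21 |-> 1 sends to 0.) *)
Definition B1 : Type := presented B1_rel.
HB.instance Definition _ := GRing.PzRing.on B1.

Definition xB i j : B1 := pclass B1_rel (u LX i j).
Definition yB i j : B1 := pclass B1_rel (u LY i j).

Definition angle j k i : B1 := yB j k * xB k i * yB i j.

Lemma arc_rev_subproof (a : arc m) : (val a).2 != (val a).1.
Proof. by rewrite eq_sym; exact: (svalP a). Qed.

Definition arc_rev (a : arc m) : arc m :=
  exist _ ((val a).2, (val a).1) (arc_rev_subproof a).

Definition gen_sigma (g : gen m) : gen m :=
  let: Gen c inv a := g in Gen c inv (arc_rev a).

Definition gen_tau (g : gen m) : gen m :=
  let: Gen c inv a := g in Gen (swap_letter c) inv (arc_rev a).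

Definition B1_sigma : B1 -> B1 := @pres_rev _ B1_rel gen_sigma.
Definition B1_tau : B1 -> B1 := @pres_rev _ B1_rel gen_tau.

Lemma gterm_sigma c inv i j :
  pterm_rev gen_sigma (gterm c inv i j) = gterm c inv j i.
Proof.
rewrite /gterm; case: insubP => [a /= ij va | /= /negPn/eqP ->].
  rewrite insubT /=; first by rewrite eq_sym.
  by move=> ji; congr (PGen (Gen _ _ _)); apply: val_inj; rewrite /= va.
by rewrite insubF //= eqxx.
Qed.

Lemma gterm_tau c inv i j :
  pterm_rev gen_tau (gterm c inv i j) = gterm (swap_letter c) inv j i.
Proof.
rewrite /gterm; case: insubP => [a /= ij va | /= /negPn/eqP ->].
  rewrite insubT /=; first by rewrite eq_sym.
  by move=> ji; congr (PGen (Gen _ _ _)); apply: val_inj; rewrite /= va.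
by rewrite insubF //= eqxx.
Qed.

Let rel_cong s t : D2_rel s t -> pcong B1_rel s t.
Proof. by move=> st; apply/pcong_rel/B1_D2. Qed.

Let triangle c i j k : i != j -> j != k -> k != i ->
  pcong B1_rel (ui c i j ** (u c i k ** ui c j k))
               (ui c k j ** (u c k i ** ui c j i)).
Proof.
move=> ij jk ki; apply: (pcong_trans (pcong_mulA _ _ _ _)).
apply: (pcong_trans _ (pcong_sym (pcong_mulA _ _ _ _))).
exact/pcong_sym/rel_cong/D2_triangle.
Qed.

Let exchange c i j k l : cyclic4 i j k l ->
  pcong B1_rel (u c j l)
    (u c j i ** (ui c k i ** u c k l) ++ u c j k ** (ui c i k ** u c i l)).
Proof.
move=> ijkl; have klij : cyclic4 k l i j.
  by move: ijkl; rewrite /cyclic4; case/or4P=> ->; rewrite ?orbT.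
apply: (pcong_trans (rel_cong (D2_exchange c klij))).
by apply: pcong_add; apply: pcong_sym; exact: pcong_mulA.
Qed.

Lemma sigma_rel s t : B1_rel s t ->
  pcong B1_rel (pterm_rev gen_sigma s) (pterm_rev gen_sigma t).
Proof.
case=> {s t}.
- move=> s t [] {s t} /= *; rewrite !gterm_sigma.
  + by apply: rel_cong; apply: D2_invr; rewrite eq_sym.
  + by apply: rel_cong; apply: D2_invl; rewrite eq_sym.
  + exact: triangle.
  + exact: exchange.
- move=> i j ij /=; rewrite !gterm_sigma.
  by apply/pcong_sym/pcong_rel; exact: B1_norm.
- move=> i j t ij /=; rewrite !gterm_sigma; set s := pterm_rev _ t.
  have c := pcong_sym (pcong_rel (B1_norm ij)).
  apply: (pcong_trans (pcong_mul (pcong_refl _ s) c)).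
  apply: (pcong_trans _ (pcong_mul (pcong_sym c) (pcong_refl _ s))).
  by apply/pcong_sym/pcong_rel; exact: B1_central.
Qed.

Lemma tau_rel s t : B1_rel s t ->
  pcong B1_rel (pterm_rev gen_tau s) (pterm_rev gen_tau t).
Proof.
case=> {s t}.
- move=> s t [] {s t} /= *; rewrite !gterm_tau.
  + by apply: rel_cong; apply: D2_invr; rewrite eq_sym.
  + by apply: rel_cong; apply: D2_invl; rewrite eq_sym.
  + exact: triangle.
  + exact: exchange.
- by move=> i j ij /=; rewrite !gterm_tau /=; apply/pcong_rel; exact: B1_norm.
- move=> i j t ij /=; rewrite !gterm_tau /=.
  by apply/pcong_sym/pcong_rel; exact: B1_central.
Qed.

Lemma B1_sigmaM a b : B1_sigma (a * b) = B1_sigma b * B1_sigma a.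
Proof. exact/pres_revM/sigma_rel. Qed.
Lemma B1_sigma_x i j : B1_sigma (xB i j) = xB j i.
Proof. by rewrite /B1_sigma pres_rev_class ?gterm_sigma //; exact: sigma_rel. Qed.
Lemma B1_sigma_y i j : B1_sigma (yB i j) = yB j i.
Proof. by rewrite /B1_sigma pres_rev_class ?gterm_sigma //; exact: sigma_rel. Qed.
Lemma B1_tauM a b : B1_tau (a * b) = B1_tau b * B1_tau a.
Proof. exact/pres_revM/tau_rel. Qed.
Lemma B1_tau_x i j : B1_tau (xB i j) = yB j i.
Proof. by rewrite /B1_tau pres_rev_class ?gterm_tau //; exact: tau_rel. Qed.
Lemma B1_tau_y i j : B1_tau (yB i j) = xB j i.
Proof. by rewrite /B1_tau pres_rev_class ?gterm_tau //; exact: tau_rel. Qed.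

End Polygon.

Section Clifford.
Variables (R : realType) (n : nat).
Implicit Types (A B C : {set 'I_n}) (u v : 'rV[R]_n).

(* Signature (1, n - 1): the first basis vector has square 1 and the others
   have square -1. *)
Definition qsign (i : 'I_n) : R := if i == 0%N :> nat then 1 else -1.

Definition bform u v : R := \sum_i qsign i * (u 0 i * v 0 i).
Definition qform v : R := bform v v.

(* An element is given by its coordinates in the basis of the products
   e_A = e_(i_1) * ... * e_(i_k) over A = {i_1 < ... < i_k}; see clA_prod. *)
Definition Cl : Type := 'rV[R]_#|{: {set 'I_n}}|.
HB.instance Definition _ := NormedModule.on Cl.

Definition clc (x : Cl) A : R := x 0 (enum_rank A).
Definition clA A : Cl := delta_mx 0 (enum_rank A).

Definition symd A B : {set 'I_n} := (A :\: B) :|: (B :\: A).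

(* e_i * e_j = swapsign i j * (the product of e_i and e_j in increasing order,
   with squares removed), and e_A * e_B = clsign A B * e_(A symd B). *)
Definition swapsign (i j : 'I_n) : R :=
  if (i < j)%N then 1 else if i == j then qsign i else -1.
Definition clsign A B : R := \prod_(i in A) \prod_(j in B) swapsign i j.

Definition cl_mul (x y : Cl) : Cl :=
  \sum_A \sum_B (clc x A * clc y B * clsign A B) *: clA (symd A B).

Lemma clcE A B : clc (clA A) B = (B == A)%:R.
Proof. by rewrite /clc /clA mxE eqxx (inj_eq enum_rank_inj). Qed.

Lemma clP (x y : Cl) : clc x =1 clc y -> x = y.
Proof. by move=> xy; apply/rowP => k; have := xy (enum_val k); rewrite /clc enum_valK. Qed.

Lemma clcD (x y : Cl) A : clc (x + y) A = clc x A + clc y A.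
Proof. by rewrite /clc mxE. Qed.
Lemma clcZ (a : R) (x : Cl) A : clc (a *: x) A = a * clc x A.
Proof. by rewrite /clc mxE. Qed.
Lemma clc_sum (I : Type) (r : seq I) (P : pred I) (F : I -> Cl) A :
  clc (\sum_(i <- r | P i) F i) A = \sum_(i <- r | P i) clc (F i) A.
Proof. by rewrite /clc summxE. Qed.

Lemma cl_decomp (x : Cl) : x = \sum_A clc x A *: clA A.
Proof.
apply: clP => B; rewrite clc_sum (bigD1 B) //= clcZ clcE eqxx mulr1.
by rewrite big1 ?addr0 // => A AB; rewrite clcZ clcE eq_sym (negbTE AB) mulr0.
Qed.

Lemma symdP A B i : (i \in symd A B) = (i \in A) (+) (i \in B).
Proof. by rewrite !inE; case: (i \in A); case: (i \in B). Qed.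

Lemma symdA : associative symd.
Proof. by move=> A B C; apply/setP => i; rewrite !symdP addbA. Qed.
Lemma symdC : commutative symd.
Proof. by move=> A B; apply/setP => i; rewrite !symdP addbC. Qed.
Lemma sym0d : left_id finset.set0 symd.
Proof. by move=> A; apply/setP => i; rewrite !symdP inE. Qed.
Lemma symd0 : right_id finset.set0 symd.
Proof. by move=> A; rewrite symdC sym0d. Qed.
Lemma symdd A : symd A A = finset.set0.
Proof. by apply/setP => i; rewrite !symdP addbb inE. Qed.
Lemma symdK A : involutive (symd A).
Proof. by move=> B; rewrite symdA symdd sym0d. Qed.
Lemma eq_symd A B C : (C == symd A B) = (B == symd A C).
Proof. by apply/eqP/eqP => ->; rewrite symdK. Qed.

Lemma qsign_sqr i : qsign i * qsign i = 1.
Proof. by rewrite /qsign; case: ifP => _; rewrite ?mulrNN mulr1. Qed.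
Lemma swapsign_sqr i j : swapsign i j * swapsign i j = 1.
Proof.
rewrite /swapsign; case: ifP => _; first by rewrite mulr1.
by case: ifP => _; rewrite ?qsign_sqr // mulrNN mulr1.
Qed.

Lemma prod_symd A B (F : 'I_n -> R) : (forall i, F i * F i = 1) ->
  \prod_(i in symd A B) F i = (\prod_(i in A) F i) * \prod_(i in B) F i.
Proof.
move=> F2; rewrite !(big_mkcond (fun i => i \in _)) /= -big_split /=.
apply: eq_bigr => i _; rewrite symdP.
by case: (i \in A); case: (i \in B); rewrite ?F2 ?mulr1 ?mul1r.
Qed.

Lemma clsignDl A B C : clsign (symd A B) C = clsign A C * clsign B C.
Proof.
apply: prod_symd => i; rewrite -big_split big1 //= => j _.
exact: swapsign_sqr.
Qed.
Lemma clsignDr A B C : clsign A (symd B C) = clsign A B * clsign A C.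
Proof.
rewrite /clsign -big_split; apply: eq_bigr => i _; apply: prod_symd => j.
exact: swapsign_sqr.
Qed.
Lemma clsign_sqr A B : clsign A B * clsign A B = 1.
Proof.
rewrite /clsign -big_split big1 //= => i _; rewrite -big_split big1 //= => j _.
exact: swapsign_sqr.
Qed.
Lemma clsign0l A : clsign finset.set0 A = 1. Proof. by rewrite /clsign big_set0. Qed.
Lemma clsign0r A : clsign A finset.set0 = 1.
Proof. by rewrite /clsign big1 // => i _; rewrite big_set0. Qed.

Lemma clc_mul (x y : Cl) C :
  clc (cl_mul x y) C =
  \sum_A clc x A * clc y (symd A C) * clsign A (symd A C).
Proof.
rewrite clc_sum; apply: eq_bigr => A _.
rewrite clc_sum (bigD1 (symd A C)) //= clcZ clcE symdK eqxx mulr1.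
by rewrite big1 ?addr0 // => B; rewrite eq_symd clcZ clcE => /negbTE ->; rewrite mulr0.
Qed.

Let cl_mulA : associative cl_mul.
Proof.
move=> x y z; apply: clP => D; rewrite !clc_mul.
transitivity (\sum_A \sum_B clc x A * clc y B * clc z (symd B (symd A D)) *
    (clsign B (symd B (symd A D)) * clsign A (symd A D))).
  apply: eq_bigr => A _; rewrite clc_mul mulr_sumr mulr_suml.
  by apply: eq_bigr => B _; rewrite !mulrA.
transitivity (\sum_A \sum_C clc x A * clc y (symd A C) * clc z (symd C D) *
    (clsign A (symd A C) * clsign C (symd C D))); last first.
  rewrite exchange_big /=; apply: eq_bigr => C _; rewrite clc_mul !mulr_suml.
  by apply: eq_bigr => A _; rewrite -!mulrA; congr (_ * (_ * _)); rewrite mulrCA.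
apply: eq_bigr => A _; rewrite (reindex_inj (inv_inj (symdK A))) /=.
apply: eq_bigr => C _.
have -> : symd (symd A C) (symd A D) = symd C D.
  by rewrite [symd A C]symdC -symdA symdK.
congr (_ * _).
have -> : symd A D = symd (symd A C) (symd C D) by rewrite -symdA symdK.
rewrite [clsign (symd A C) _]clsignDl [clsign A (symd (symd _ _) _)]clsignDr.
by rewrite [clsign A (symd C D) * _]mulrC mulrACA clsign_sqr mulr1 mulrC.
Qed.

Let cl_mul1l : left_id (clA finset.set0) cl_mul.
Proof.
move=> x; apply: clP => C; rewrite clc_mul (bigD1 finset.set0) //= clcE eqxx sym0d.
rewrite clsign0l mul1r mulr1 big1 ?addr0 // => A /negbTE A0.
by rewrite clcE A0 !mul0r.
Qed.
Let cl_mul1r : right_id (clA finset.set0) cl_mul.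
Proof.
move=> x; apply: clP => C; rewrite clc_mul (bigD1 C) //= clcE symdd eqxx.
rewrite clsign0r !mulr1 big1 ?addr0 // => A AC.
rewrite clcE; case: eqP => [A0|_]; last by rewrite mulr0 mul0r.
by case/eqP: AC; rewrite -[C](symdK A) A0 symd0.
Qed.
Let cl_mulDl : left_distributive cl_mul +%R.
Proof.
move=> x y z; apply: clP => C; rewrite clcD !clc_mul -big_split /=.
by apply: eq_bigr => A _; rewrite clcD !mulrDl.
Qed.
Let cl_mulDr : right_distributive cl_mul +%R.
Proof.
move=> x y z; apply: clP => C; rewrite clcD !clc_mul -big_split /=.
by apply: eq_bigr => A _; rewrite clcD mulrDr !mulrDl.
Qed.
Let cl_1neq0 : clA finset.set0 != 0 :> Cl.
Proof.
apply/eqP => /(congr1 (clc^~ finset.set0)); rewrite clcE eqxx /clc mxE.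
by move/eqP; rewrite oner_eq0.
Qed.

HB.instance Definition _ := GRing.Zmodule_isNzRing.Build Cl
  cl_mulA cl_mul1l cl_mul1r cl_mulDl cl_mulDr cl_1neq0.

Let cl_scaleAl (a : R) (x y : Cl) : a *: (x * y) = (a *: x) * y.
Proof.
apply: clP => C; rewrite clcZ !clc_mul mulr_sumr.
by apply: eq_bigr => A _; rewrite clcZ !mulrA.
Qed.
HB.instance Definition _ := GRing.Lmodule_isLalgebra.Build R Cl cl_scaleAl.

Let cl_scaleAr (a : R) (x y : Cl) : a *: (x * y) = x * (a *: y).
Proof.
apply: clP => C; rewrite clcZ !clc_mul mulr_sumr.
by apply: eq_bigr => A _; rewrite clcZ !mulrA [a * _]mulrC.
Qed.
HB.instance Definition _ := GRing.Lalgebra_isAlgebra.Build R Cl cl_scaleAr.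

Definition cl_unit : pred Cl := fun x => `[< exists y, y * x = 1 /\ x * y = 1 >].
Definition cl_inv (x : Cl) : Cl := xget x [set y | y * x = 1 /\ x * y = 1].

Let cl_mulVr : {in cl_unit, left_inverse 1 cl_inv *%R}.
Proof. by move=> x /asboolP xU; have [] := xgetPex x xU. Qed.
Let cl_divrr : {in cl_unit, right_inverse 1 cl_inv *%R}.
Proof. by move=> x /asboolP xU; have [] := xgetPex x xU. Qed.
Let cl_unitrP (x y : Cl) : y * x = 1 /\ x * y = 1 -> cl_unit x.
Proof. by move=> xy; apply/asboolP; exists y. Qed.
Let cl_invr_out : {in [predC cl_unit], cl_inv =1 id}.
Proof.
move=> x /negP xU; apply: xgetPN => y xy; apply: xU.
exact/asboolP/(ex_intro _ y xy).
Qed.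
HB.instance Definition _ := GRing.NzRing_hasMulInverse.Build Cl
  cl_mulVr cl_divrr cl_unitrP cl_invr_out.

Lemma clA_mul A B : clA A * clA B = clsign A B *: clA (symd A B).
Proof.
apply: clP => C; rewrite clc_mul clcZ clcE (bigD1 A) //= !clcE eqxx mul1r.
rewrite big1 => [|A' /negbTE A'A]; last by rewrite clcE A'A !mul0r.
rewrite addr0 eq_sym eq_symd; case: eqP => [->|_]; last by rewrite mul0r mulr0.
by rewrite symdK mul1r mulr1.
Qed.

Definition clv v : Cl := \sum_i v 0 i *: clA [set i]%SET.

Lemma clvM u v : clv u * clv v + clv v * clv u = (2 * bform u v)%:A.
Proof.
have dbl w z : clv w * clv z =
    \sum_i \sum_j (w 0 i * z 0 j) *: (clA [set i]%SET * clA [set j]%SET).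
  rewrite mulr_suml; apply: eq_bigr => i _; rewrite mulr_sumr.
  by apply: eq_bigr => j _; rewrite -scalerAl -scalerAr scalerA.
rewrite !dbl [X in _ + X]exchange_big /= -big_split /=.
rewrite /bform mulr_sumr scaler_suml; apply: eq_bigr => i _.
rewrite -big_split /= (bigD1 i) //= [X in _ + X]big1 => [|j ji].
  rewrite addr0 [v 0 i * _]mulrC clA_mul symdd /clsign !big_set1.
  rewrite /swapsign ltnn eqxx !scalerA -scalerDl; congr (_ *: _).
  by rewrite mulrDl mul1r mulrC.
rewrite [v 0 j * _]mulrC -scalerDr !clA_mul [symd [set j]%SET _]symdC -scalerDl.
rewrite /clsign !big_set1 /swapsign [i == j]eq_sym (negbTE ji).
by case: ltngtP (ji : val j != val i) => // _ _;
  rewrite ?subrr ?addNr scale0r scaler0.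
Qed.

Lemma clv_sqr v : clv v * clv v = (qform v)%:A.
Proof.
apply: (@scalerI _ _ (2 : R)); first by rewrite pnatr_eq0.
by rewrite scalerA -clvM scaler_nat.
Qed.

(* The basis element e_A is the ordered product of its vectors, so Cl is
   generated by the vectors. *)
Lemma clA_prod A : clA A = \prod_(i <- enum A) clA [set i]%SET.
Proof.
have ltE (s : seq 'I_n) : sorted (fun i j : 'I_n => (i < j)%N) s ->
    \prod_(i <- s) clA [set i]%SET = clA [set i in s]%SET.
  elim: s => [|i s IH] s_sorted.
    rewrite big_nil; have -> // : [set j : 'I_n in [::]]%SET = finset.set0.
    by apply/setP => j; rewrite !inE.
  rewrite big_cons IH ?(path_sorted s_sorted) // clA_mul.
  have is_lt : all (fun j : 'I_n => (i < j)%N) s.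
    by apply: order_path_min s_sorted => a b c; exact: ltn_trans.
  have -> : clsign [set i]%SET [set j in s]%SET = 1.
    rewrite /clsign big_set1 big1 // => j; rewrite inE => js.
    by rewrite /swapsign (allP is_lt).
  rewrite scale1r; congr clA; apply/setP => j; rewrite symdP !inE.
  case: eqP => [->|//]; case: (boolP (i \in s)) => //.
  by move=> /(allP is_lt); rewrite ltnn.
rewrite ltE; first by congr clA; apply/setP => i; rewrite inE mem_enum.
rewrite /enum_mem -enumT; apply: sorted_filter.
  by move=> a b c; exact: ltn_trans.
have := iota_ltn_sorted 0 n; rewrite -val_enum_ord sorted_map.
by [].
Qed.

(* x |-> x^T reverses the k factors of e_A, which has the sign of the
   permutation with k(k-1)/2 inversions. *)
Definition cl_tr (x : Cl) : Cl :=
  \sum_(A : {set 'I_n}) ((-1) ^+ 'C(#|A|, 2) * clc x A) *: clA A.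
Definition cl_alpha (x : Cl) : Cl :=
  \sum_(A : {set 'I_n}) ((-1) ^+ #|A| * clc x A) *: clA A.

Lemma clc_sumA (F : {set 'I_n} -> R) B : clc (\sum_A F A *: clA A) B = F B.
Proof.
rewrite clc_sum (bigD1 B) //= clcZ clcE eqxx mulr1 big1 ?addr0 // => A AB.
by rewrite clcZ clcE eq_sym (negbTE AB) mulr0.
Qed.

Lemma clsign_diag A :
  clsign A A * \prod_(i in A) qsign i = (-1) ^+ 'C(#|A|, 2).
Proof.
have [k] := ubnP #|A|; elim: k A => // k IHk B.
have [->|[a aB]] := set_0Vmem B; first by rewrite clsign0l big_set0 mulr1 cards0.
rewrite (cardsD1 a) aB add1n -[B in clsign B B](finset.setD1K aB).
rewrite -[B in X in _ * X](finset.setD1K aB) ltnS => /IHk.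
have {aB} : a \notin (B :\ a)%SET by rewrite !inE eqxx.
move: (B :\ a)%SET => A aA IH;
set k1 := #|A|.+1; have -> : (a |: A)%SET = symd [set a]%SET A.
  by apply/setP => i; rewrite symdP !inE; case: eqP => [->|//]; rewrite (negbTE aA).
rewrite clsignDl !clsignDr prod_symd; last exact: qsign_sqr.
have -> : clsign [set a]%SET [set a]%SET = \prod_(i in [set a]%SET) qsign i.
  by rewrite /clsign !big_set1 /swapsign ltnn eqxx.
have anti : clsign [set a]%SET A * clsign A [set a]%SET = (-1) ^+ #|A|.
  rewrite /clsign big_set1 -big_split /= -prodr_const.
  apply: eq_bigr => i iA; rewrite big_set1 /swapsign [i == a]eq_sym.
  have /negbTE ai : a != i by apply: contraNneq aA => ->.
  by rewrite ai; case: ltngtP (negbT ai : val a != val i) => // _ _; rewrite ?mulr1 ?mul1r.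
rewrite /k1 binS bin1 exprD -IH -anti.
set p := \prod_(i in [set a]%SET) _; set q := \prod_(i in A) _.
have pp : p * p = 1 by rewrite /p big_set1 qsign_sqr.
transitivity ((p * p) * (clsign A A * q * (clsign [set a]%SET A * clsign A [set a]%SET))).
  by ring.
by rewrite pp mul1r.
Qed.

Lemma cl_trM (x y : Cl) : cl_tr (x * y) = cl_tr y * cl_tr x.
Proof.
apply: clP => C; rewrite clc_sumA !clc_mul mulr_sumr.
have symdCK : involutive (symd^~ C) by move=> A; rewrite -symdA symdd symd0.
rewrite [RHS](reindex_inj (inv_inj symdCK)) /=.
apply: eq_bigr => A _; rewrite symdCK !clc_sumA.
have CE : C = symd A (symd A C) by rewrite symdK.
move: (symd A C) CE => B ->.
rewrite -!clsign_diag clsignDl !clsignDr prod_symd; last exact: qsign_sqr.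
set p := \prod_(i in A) _; set q := \prod_(i in B) _.
transitivity ((clsign A B * clsign A B) * (clsign A A * clsign B B * p * q *
  clsign B A * clc x A * clc y B)); first by ring.
by rewrite clsign_sqr; ring.
Qed.

Lemma cl_alphaM (x y : Cl) : cl_alpha (x * y) = cl_alpha x * cl_alpha y.
Proof.
apply: clP => C; rewrite clc_sumA !clc_mul mulr_sumr.
apply: eq_bigr => A _; rewrite !clc_sumA.
have -> : (-1) ^+ #|C| = (-1) ^+ #|A| * (-1) ^+ #|symd A C| :> R.
  rewrite -{1}(symdK A C) -!prodr_const prod_symd // => i.
  by rewrite mulrNN mulr1.
by ring.
Qed.

Lemma cl_tr_clv v : cl_tr (clv v) = clv v.
Proof.
apply: clP => A; rewrite clc_sumA /clv clc_sum mulr_sumr.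
apply: eq_bigr => i _; rewrite clcZ clcE.
by case: eqP => [->|_]; rewrite ?mulr0 // cards1 bin_small // expr0 mul1r.
Qed.

Lemma cl_alpha_clv v : cl_alpha (clv v) = - clv v.
Proof.
apply: clP => A; rewrite clc_sumA /clv -sumrN !clc_sum mulr_sumr.
apply: eq_bigr => i _; rewrite -scaleNr !clcZ clcE.
by case: eqP => [->|_]; rewrite ?mulr0 // cards1 expr1 mulN1r mulr1 mulr1.
Qed.

Definition clifford_group : set Cl :=
  [set x | x \is a GRing.unit /\
           forall v, exists w, cl_alpha x * clv v * x^-1 = clv w].
Definition cl_even : set Cl := [set x | cl_alpha x = x].

Definition positive_norm : set Cl :=
  [set x | exists2 r : R, 0 < r & x * cl_tr x = r%:A].

Variable e : 'rV[R]_n.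

Definition sigma_e (x : Cl) : Cl := clv e * cl_tr x * clv e.

Definition eV : set Cl := [set clv e * clv v | v in [set: 'rV[R]_n]].

(* The component containing e of the double cone of the vectors of positive
   norm. *)
Definition Vpos : set 'rV[R]_n := [set v | 0 < qform v /\ 0 < bform e v].
Definition eVpos : set Cl := [set clv e * clv v | v in Vpos].

Definition mx2 (a b c d : Cl) : 'M[Cl]_2 :=
  \matrix_(i, j) if i == 0 then (if j == 0 then a else b)
                 else (if j == 0 then c else d).

(* The matrices preserving the sigma_e-sesquilinear form with Gram matrix
   (0 1; -1 0). *)
Definition Sp2 : set 'M[Cl]_2 :=
  [set g : 'M[Cl]_2 | (map_mx sigma_e g)^T *m mx2 0 1 (-1) 0 *m g = mx2 0 1 (-1) 0].

(* R^{2,n} = R^{1,1} + R^{1,n-1} as a space of matrices: W2n s t v has square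
   q(v) + s t, so M_2(Cl) is the Clifford algebra of R^{2,n}, the grading being
   given by the parity of the entries. *)
Definition W2n (s t : R) (v : 'rV[R]_n) : 'M[Cl]_2 :=
  mx2 (clv v) (s *: clv e) (t *: clv e) (- (clv e * clv v * clv e)).

Lemma W2n_sqr s t v : qform e = 1 ->
  W2n s t v *m W2n s t v = ((qform v + s * t)%:A)%:M.
Proof.
move=> qe; have ee : clv e * clv e = 1 by rewrite clv_sqr qe scale1r.
have vv := clv_sqr v.
have H (a b c d a' b' c' d' : Cl) : mx2 a b c d *m mx2 a' b' c' d' =
    mx2 (a * a' + b * c') (a * b' + b * d') (c * a' + d * c') (c * b' + d * d').
  apply/matrixP => i j; rewrite !mxE big_ord_recl big_ord1 !mxE /=.
  by case: (i == 0); case: (j == 0).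
have E : (clv e * clv v * clv e) * (clv e * clv v * clv e) = (qform v)%:A.
  rewrite !mulrA -[X in X * clv v * clv e]mulrA ee mulr1.
  by rewrite -[X in X * clv e]mulrA vv -scalerAr mulr1 -scalerAl ee.
rewrite /W2n H; apply/matrixP => i j; rewrite !mxE.
rewrite -!scalerAl -!scalerAr !scalerA ee vv !mulrN !mulNr opprK E !mulrA ee mul1r.
rewrite -[clv e * clv v * clv e * clv e]mulrA ee mulr1.
case: i => [[|[|//]] ?]; case: j => [[|[|//]] ?]; rewrite /= -?val_eqE /= ?mulr1n ?mulr0n.
- by rewrite scalerDl.
- by rewrite -scalerDr subrr scaler0.
- by rewrite -scalerDr subrr scaler0.
- by rewrite scalerDl addrC [t * s]mulrC.
Qed.

(* The elements of the Clifford group of R^{2,n} that are even and in Sp_2.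
   The anti-involution of M_2(Cl) defining Sp_2 is -1 on R^{2,n}, so that for
   even g being in Sp_2 means g g^T = 1. *)
Definition Spin2n : set 'M[Cl]_2 :=
  [set g : 'M[Cl]_2 | [/\ (forall i j, cl_even (g i j)), Sp2 g
              & forall s t v, exists s' t' v',
                  g *m W2n s t v = W2n s' t' v' *m g]].

Definition line_stabilizer (s t : R) (v : 'rV[R]_n) : set 'M[Cl]_2 :=
  [set g : 'M[Cl]_2 | Spin2n g /\
     exists c : R, g *m W2n s t v = W2n (c * s) (c * t) (c *: v) *m g].

(* Two opposite maximal parabolic subgroups, for n >= 3, and the common Levi
   factor. *)
Definition P_Theta := line_stabilizer 1 0 0.
Definition P_Theta_opp := line_stabilizer 0 1 0.
Definition L_Theta := P_Theta `&` P_Theta_opp.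
Definition L_Theta0 := connected_component L_Theta 1%:M.

(* The unipotent radicals of P_Theta and P_Theta_opp consist of the upper and
   lower unitriangular matrices with off-diagonal entry in e V. *)
Definition U_Theta_pos : set 'M[Cl]_2 := [set mx2 1 z 0 1 | z in eVpos].
Definition U_Theta_opp_pos : set 'M[Cl]_2 := [set mx2 1 0 y 1 | y in eVpos].

(* The products of elements of the three generating sets in which both
   unipotent ones occur.  The products without this condition also include
   the elements of L_Theta0, in particular 1, which belong to the boundary and
   not to the (open) positive semigroup. *)
Definition Spin2n_pos : set 'M[Cl]_2 :=
  [set g : 'M[Cl]_2 | exists s : seq 'M[Cl]_2,
     [/\ {in s, forall h, (U_Theta_pos `|` U_Theta_opp_pos `|` L_Theta0) h},
         (exists2 h, h \in s & U_Theta_pos h),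
         (exists2 h, h \in s & U_Theta_opp_pos h)
       & g = foldr mulmx 1%:M s]].

(* A ring homomorphism between algebras over rat is linear over rat. *)
Section Points.
Variable m : nat.
Implicit Types phi : {rmorphism B1 m -> Cl}.

Definition Cl_point phi : Prop :=
  [/\ forall a, phi (B1_sigma a) = sigma_e (phi a),
      forall a, phi (B1_tau a) = cl_tr (phi a),
      forall i j, i != j -> clifford_group (phi (xB i j))
    & forall i j k, i != j -> j != k -> k != i -> eV (phi (angle j k i))].

Definition positive_point phi : Prop :=
  [/\ Cl_point phi,
      forall i j k, i != j -> j != k -> k != i -> eVpos (phi (angle j k i))
    & forall i j, i != j -> positive_norm (phi (xB i j))].

(* An element of the Clifford group is even or odd.  There are points with odd
   arcs, such as x_13 |-> e, and their matrices are not in Spin(2,n). *)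
Definition even_arcs phi : Prop :=
  forall i j, i != j -> cl_even (phi (xB i j)).
End Points.

Definition p1 : 'I_4 := @Ordinal 4 0 isT.
Definition p2 : 'I_4 := @Ordinal 4 1 isT.
Definition p3 : 'I_4 := @Ordinal 4 2 isT.
Definition p4 : 'I_4 := @Ordinal 4 3 isT.

Implicit Types phi : {rmorphism B1 4 -> Cl}.

Definition normalized phi : Prop := phi (xB p1 p2) = 1 /\ phi (xB p3 p4) = 1.

Definition point_mx phi : 'M[Cl]_2 :=
  let x := phi (xB p1 p3) in
  let z := x^-1 * phi (xB p1 p4) in
  let y := phi (xB p2 p3) * x^-1 in
  mx2 1 0 y 1 *m mx2 x 0 0 (sigma_e x)^-1 *m mx2 1 z 0 1.

End Clifford.

Definition parameterizes (A B : pzRingType) (T : Type)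
    (f : {rmorphism A -> B} -> T) (P : set {rmorphism A -> B}) (S : set T) :=
  (forall phi psi, P phi -> P psi -> f phi = f psi -> phi =1 psi) /\
  f @` P = S.

(* Main.v *)
Require Import Defs.
From HB Require Import structures.
From mathcomp Require Import all_boot all_order all_algebra.
From mathcomp Require Import all_classical all_reals all_analysis.
From mathcomp Require Import ring lra zify.

Set Implicit Arguments.
Unset Strict Implicit.
Unset Printing Implicit Defensive.

Import Order.TTheory GRing.Theory Num.Theory.
Import numFieldNormedType.Exports.
Local Open Scope classical_set_scope.
Local Open Scope ring_scope.

(* A point is determined by the images a, b, c, d of x_13, x_14, x_23, x_24, and
   the exchange relation for x_24 says that its matrix is (a b; c d), with Gauss
   decomposition given by y = c a^-1, a, z = a^-1 b, where y and z are angles up to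
   real factors.  Conversely, as e V is stable under sums, inverses and
   w |-> u w sigma(u), all angles lie in e V as soon as y and z do.  An element g of
   Spin(2,n) with invertible entries has such a decomposition: y in e V is read off
   the image under g of an isotropic vector, and peeling off the lower factor leaves
   an element whose action on V and on another isotropic vector gives that a is in
   the Clifford group and z in e V.  Hence the image of the points is cut out by the
   open condition that the entries be units.

   The cone e V^+ is stable under the same operations, so that positive points
   correspond to the triples with y, z in e V^+ and a of positive norm.  These
   matrices absorb the generators of the semigroup because
   1 + z y = z (z^-1 + y).  Finally, for n >= 3 the even Clifford elements of
   positive norm form a connected group: products of two vectors move such an
   element, along segments, to one that fixes all basis vectors but one, which is
   then a real scalar. *)

(** * The even Clifford group and its norm *)

Section CliffordBasics.
Variables (R : realType) (n : nat).
Local Notation Cl := (Cl R n).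
Implicit Types (x y z : Cl) (u v w : 'rV[R]_n) (r : R) (A : {set 'I_n}).

(** The scalar coordinate gives a total function, continuous in [x]. For even Clifford elements
    [x * cl_tr x] is a scalar, and this is the norm. *)
Definition spinor_norm x : R := clc (x * cl_tr x) finset.set0.

Lemma clc_tr x A : clc (cl_tr x) A = (-1) ^+ 'C(#|A|, 2) * clc x A.
Proof. exact: clc_sumA. Qed.

Lemma clc_alpha x A : clc (cl_alpha x) A = (-1) ^+ #|A| * clc x A.
Proof. exact: clc_sumA. Qed.

Lemma clcM x y A :
  clc (x * y) A = \sum_B clc x B * clc y (symd B A) * clsign R B (symd B A).
Proof. exact: clc_mul. Qed.

Lemma clc1 A : clc (1 : Cl) A = (A == finset.set0)%:R.
Proof. exact: clcE. Qed.

Lemma clc_scalar r A : clc (r%:A : Cl) A = r * (A == finset.set0)%:R.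
Proof. by rewrite clcZ clc1. Qed.

Lemma scalar_inj : injective (fun r => r%:A : Cl).
Proof.
by move=> r s /(congr1 (fun z : Cl => clc z finset.set0)); rewrite !clc_scalar eqxx !mulr1.
Qed.

Lemma cl_trK : involutive (@cl_tr R n).
Proof.
by move=> x; apply: clP => A; rewrite !clc_tr mulrA -exprMn mulrNN mulr1 expr1n mul1r.
Qed.

Lemma cl_trD x y : cl_tr (x + y) = cl_tr x + cl_tr y.
Proof. by apply: clP => A; rewrite clcD !clc_tr clcD mulrDr. Qed.

Lemma cl_trZ r x : cl_tr (r *: x) = r *: cl_tr x.
Proof. by apply: clP => A; rewrite clcZ !clc_tr clcZ mulrCA. Qed.

Lemma cl_tr0 : cl_tr (0 : Cl) = 0.
Proof. by rewrite -(scale0r (0 : Cl)) cl_trZ !scale0r. Qed.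

Lemma cl_tr1 : cl_tr (1 : Cl) = 1.
Proof.
apply: clP => A; rewrite clc_tr clc1; case: eqP => [->|_]; last by rewrite mulr0.
by rewrite cards0 mulr1.
Qed.

Lemma cl_alphaD x y : cl_alpha (x + y) = cl_alpha x + cl_alpha y.
Proof. by apply: clP => A; rewrite clcD !clc_alpha clcD mulrDr. Qed.

Lemma cl_alphaZ r x : cl_alpha (r *: x) = r *: cl_alpha x.
Proof. by apply: clP => A; rewrite clcZ !clc_alpha clcZ mulrCA. Qed.

Lemma cl_alpha1 : cl_alpha (1 : Cl) = 1.
Proof.
apply: clP => A; rewrite clc_alpha clc1; case: eqP => [->|_]; last by rewrite mulr0.
by rewrite cards0 mulr1.
Qed.

Lemma cl_alpha_tr x : cl_alpha (cl_tr x) = cl_tr (cl_alpha x).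
Proof. by apply: clP => A; rewrite !(clc_alpha, clc_tr) mulrCA. Qed.

Lemma clvD u v : clv (u + v) = clv u + clv v.
Proof. by rewrite -big_split; apply: eq_bigr => i _; rewrite !mxE scalerDl. Qed.

Lemma clvZ r v : clv (r *: v) = r *: clv v.
Proof. by rewrite scaler_sumr; apply: eq_bigr => i _; rewrite !mxE scalerA. Qed.

Lemma clvN v : clv (- v) = - clv v.
Proof. by rewrite -scaleN1r clvZ scaleN1r. Qed.

Lemma clv0 : clv (0 : 'rV[R]_n) = 0.
Proof. by rewrite -(scale0r 0) clvZ !scale0r. Qed.

Lemma clv_delta i : clv (delta_mx 0 i : 'rV[R]_n) = clA R [set i]%SET.
Proof.
rewrite /clv (bigD1 i) //= mxE !eqxx scale1r big1 ?addr0 // => j /negbTE ji.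
by rewrite mxE ji andbF scale0r.
Qed.

Lemma clc_clv v i : clc (clv v) [set i]%SET = v 0 i.
Proof.
rewrite /clv clc_sum (bigD1 i) //= clcZ clcE eqxx mulr1 big1 ?addr0 // => j ji.
by rewrite clcZ clcE (inj_eq set1_inj) eq_sym (negbTE ji) mulr0.
Qed.

Lemma clv_inj : injective (@clv R n).
Proof. by move=> u v uv; apply/rowP => i; rewrite -!clc_clv uv. Qed.

Lemma clv_mulmx v (M : 'M[R]_n) : clv (v *m M) = \sum_i v 0 i *: clv (row i M).
Proof.
rewrite /clv; under [RHS]eq_bigr do rewrite scaler_sumr.
rewrite exchange_big; apply: eq_bigr => j _; rewrite mxE scaler_suml.
by apply: eq_bigr => i _; rewrite !mxE scalerA.
Qed.

Lemma bformC u v : bform u v = bform v u.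
Proof. by apply: eq_bigr => i _; rewrite [u 0 i * _]mulrC. Qed.

Lemma bformDr u v w : bform u (v + w) = bform u v + bform u w.
Proof. by rewrite -big_split; apply: eq_bigr => i _; rewrite !mxE !mulrDr. Qed.

Lemma bformZr r u v : bform u (r *: v) = r * bform u v.
Proof. by rewrite mulr_sumr; apply: eq_bigr => i _; rewrite !mxE; ring. Qed.

Lemma bformDl u v w : bform (u + v) w = bform u w + bform v w.
Proof. by rewrite bformC bformDr !(bformC w). Qed.

Lemma bformZl r u v : bform (r *: u) v = r * bform u v.
Proof. by rewrite bformC bformZr bformC. Qed.

Lemma qformD u v : qform (u + v) = qform u + qform v + 2 * bform u v.
Proof. by rewrite /qform bformDl !bformDr (bformC v u); ring. Qed.

Lemma qformZ r v : qform (r *: v) = r ^+ 2 * qform v.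
Proof. by rewrite /qform bformZl bformZr mulrA. Qed.

Lemma qform_unit v : clv v \is a GRing.unit -> qform v != 0.
Proof.
move=> vU; apply/eqP => q0; have := clv_sqr v.
rewrite q0 scale0r => /(congr1 (fun z => (clv v)^-1 * z)).
by rewrite mulKr // mulr0 => v0; move: vU; rewrite v0 unitr0.
Qed.

Lemma clv_unitP v : qform v != 0 ->
  (clv v \is a GRing.unit) /\ (clv v)^-1 = (qform v)^-1 *: clv v.
Proof.
move=> q0; have H : clv v * ((qform v)^-1 *: clv v) = 1.
  by rewrite -scalerAr clv_sqr scalerA mulVf // scale1r.
have H' : ((qform v)^-1 *: clv v) * clv v = 1.
  by rewrite -scalerAl clv_sqr scalerA mulVf // scale1r.
have vU : clv v \is a GRing.unit by apply/unitrP; exists ((qform v)^-1 *: clv v).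
by split=> //; rewrite -[LHS]mul1r -H' mulrK.
Qed.

Lemma even_clc x A : cl_even x -> odd #|A| -> clc x A = 0.
Proof.
move=> xe oA; have := congr1 (fun z : Cl => clc z A) xe; rewrite clc_alpha -signr_odd oA /=.
by rewrite mulN1r => /eqP; rewrite eq_sym -addr_eq0 -mulr2n mulrn_eq0 /= => /eqP.
Qed.

Lemma evenM x y : cl_even x -> cl_even y -> cl_even (x * y).
Proof. by move=> xe ye; rewrite /cl_even/= cl_alphaM xe ye. Qed.

Lemma evenD x y : cl_even x -> cl_even y -> cl_even (x + y).
Proof. by move=> xe ye; rewrite /cl_even/= cl_alphaD xe ye. Qed.

Lemma evenZ r x : cl_even x -> cl_even (r *: x).
Proof. by move=> xe; rewrite /cl_even/= cl_alphaZ xe. Qed.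

Lemma even1 : cl_even (1 : Cl). Proof. exact: cl_alpha1. Qed.

Lemma even0 : cl_even (0 : Cl). Proof. by rewrite -(scale0r 1); exact/evenZ/even1. Qed.

Lemma even_tr x : cl_even x -> cl_even (cl_tr x).
Proof. by move=> xe; rewrite /cl_even/= cl_alpha_tr xe. Qed.

Lemma even_clv2 u v : cl_even (clv u * clv v).
Proof. by rewrite /cl_even/= cl_alphaM !cl_alpha_clv mulrNN. Qed.

Lemma even_inv x : cl_even x -> cl_even x^-1.
Proof.
move=> xe; have [xU|xU] := boolP (x \is a GRing.unit); last by rewrite invr_out.
by apply: (mulIr xU); rewrite -{2}xe -cl_alphaM !mulVr // cl_alpha1.
Qed.


(** [e_i] anticommutes with each factor of [e_A] other than itself. *)
Lemma clsign_comm i A :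
  clsign R [set i]%SET A * clsign R A [set i]%SET = (-1) ^+ #|(A :\ i)%SET|.
Proof.
rewrite /clsign big_set1; under [X in _ * X]eq_bigr do rewrite big_set1.
rewrite -big_split /= -prodr_const big_mkcond [RHS]big_mkcond /=.
apply: eq_bigr => j _; rewrite !inE; case: (j \in A); last by rewrite andbF.
rewrite andbT /swapsign [i == j]eq_sym; case: eqP => [->|/eqP ji] /=.
  by rewrite ltnn qsign_sqr.
by case: ltngtP (ji : val j != val i) => // _ _; rewrite ?mulr1 ?mul1r.
Qed.


Lemma clc_clAl A x B : clc (clA R B * x) (symd B A) = clc x A * clsign R B A.
Proof.
rewrite clcM (bigD1 B) //= clcE eqxx mul1r symdK big1 ?addr0 // => C /negbTE CB.
by rewrite clcE CB !mul0r.
Qed.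

Lemma clc_clAr A x B : clc (x * clA R B) (symd A B) = clc x A * clsign R A B.
Proof.
rewrite clcM (bigD1 A) //= clcE symdK eqxx mulr1 big1 ?addr0 // => C CA.
rewrite clcE; case: eqP => [E|_]; last by rewrite mulr0 mul0r.
case/eqP: CA; rewrite -[C](symdK (symd A B)) -[symd _ C]symdC E.
by rewrite -symdA symdd symd0.
Qed.

(** As [A] without [i] has odd cardinality, [e_i] anticommutes with [e_A]; comparing the coordinates
    at the index of [e_i e_A] shows that the coordinate of [x] equals its opposite. *)
Lemma comm_clA i x A : i \in A -> ~~ odd #|A| ->
  clA R [set i]%SET * x = x * clA R [set i]%SET -> clc x A = 0.
Proof.
move=> iA eA /(congr1 (fun z : Cl => clc z (symd [set i]%SET A))).
rewrite clc_clAl symdC clc_clAr => /(congr1 ( *%R^~ (clsign R A [set i]%SET))).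
rewrite -!mulrA clsign_sqr mulr1 clsign_comm; move: eA.
rewrite (cardsD1 i A) iA /= negbK => oA; rewrite -signr_odd oA mulrN1 => /eqP.
by rewrite eq_sym -addr_eq0 -mulr2n mulrn_eq0 /= => /eqP.
Qed.

(* A nonempty set of even cardinality has an element other than i0, so it is
   enough that x commutes with all basis vectors but one. *)
Lemma even_comm_scalar i0 x : cl_even x ->
  (forall i, i != i0 -> clA R [set i]%SET * x = x * clA R [set i]%SET) ->
  x = (clc x finset.set0)%:A.
Proof.
move=> xe xC; apply: clP => A; rewrite clc_scalar.
have [->|A0] := eqVneq A finset.set0; first by rewrite mulr1.
rewrite mulr0; have [oA|eA] := boolP (odd #|A|); first exact: even_clc.
have [i iA ii0] : exists2 i, i \in A & i != i0.
  move/set0Pn: A0 => [i iA]; have [ii0|] := eqVneq i i0; last by exists i.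
  have /card_gt0P[j]: (0 < #|(A :\ i0)%SET|)%N.
    by move: eA; rewrite (cardsD1 i0) -ii0 iA; case: #|_|.
  by rewrite !inE => /andP[ji0 jA]; exists j.
exact: comm_clA iA eA (xC i ii0).
Qed.

(** For even [x] the grading automorphism disappears from the definition of the Clifford group, and
    writing the action as [x * clv v = clv w * x] avoids the inverse. *)
Definition even_clifford : set Cl := [set x |
  [/\ cl_even x, x \is a GRing.unit & forall v, exists w, x * clv v = clv w * x]].

Lemma even_cliffordP x : even_clifford x <-> clifford_group x /\ cl_even x.
Proof.
split=> [[xe xU xV]|[[xU xV] xe]]; split=> //; first split=> // v.
  by have [w E] := xV v; exists w; rewrite xe E mulrK.
by move=> v; have [w E] := xV v; exists w; rewrite -E xe mulrVK.
Qed.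

Lemma even_clifford1 : even_clifford 1.
Proof. by split=> [||v]; [exact: even1 | exact: unitr1 | exists v; rewrite mul1r mulr1]. Qed.

Lemma even_cliffordM x y : even_clifford x -> even_clifford y -> even_clifford (x * y).
Proof.
move=> [xe xU xV] [ye yU yV]; split=> [||v]; first exact: evenM.
  by rewrite unitrMr.
have [w E] := yV v; have [w' E'] := xV w.
by exists w'; rewrite -mulrA E mulrA E' mulrA.
Qed.

Lemma even_cliffordZ r x : r != 0 -> even_clifford x -> even_clifford (r *: x).
Proof.
move=> r0 [xe xU xV]; split=> [||v]; first exact: evenZ.
  apply/unitrP; exists (r^-1 *: x^-1).
  by split; rewrite -scalerAl -scalerAr scalerA ?mulVf ?mulfV // scale1r ?mulVr ?mulrV.
by have [w E] := xV v; exists w; rewrite -scalerAl E scalerAr.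
Qed.

(** When [qform u] is nonzero, the vector on the right is [- qform u] times the image of [v] under
    the reflection in [u]. *)
Lemma reflection_clv u v :
  clv u * clv v * clv u = clv ((2 * bform u v) *: u - qform u *: v).
Proof.
have E : clv u * clv v = (2 * bform u v)%:A - clv v * clv u.
  by rewrite -clvM addrK.
rewrite E mulrBl -mulrA clv_sqr -scalerAl -scalerAr mul1r mulr1.
by rewrite clvD clvZ clvN clvZ.
Qed.

Lemma even_clifford_clv2 u v :
  qform u != 0 -> qform v != 0 -> even_clifford (clv u * clv v).
Proof.
move=> qu qv; have [uU _] := clv_unitP qu; have [vU _] := clv_unitP qv.
split=> [||w]; [exact: even_clv2 | by rewrite unitrMr |].
have act (a b : 'rV[R]_n) : qform a != 0 -> exists c, clv a * clv b = clv c * clv a.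
  move=> qa; exists ((qform a)^-1 *: ((2 * bform a b) *: a - qform a *: b)).
  by rewrite clvZ -reflection_clv -scalerAl -!mulrA clv_sqr -!scalerAr scalerA mulVf // scale1r mulr1.
have [w1 E1] := act v w qv; have [w2 E2] := act u w1 qu.
by exists w2; rewrite -mulrA E1 mulrA E2 mulrA.
Qed.

(* From x v = w x one gets v x^T = x^T w, so x^T x commutes with vectors. *)
Lemma even_clifford_norm x : even_clifford x ->
  [/\ x * cl_tr x = (spinor_norm x)%:A, cl_tr x * x = (spinor_norm x)%:A,
     spinor_norm x != 0 & x^-1 = (spinor_norm x)^-1 *: cl_tr x].
Proof.
move=> [xe xU xV]; have xTC v : clv v * (cl_tr x * x) = cl_tr x * x * clv v.
  have [w E] := xV v; rewrite -mulrA E !mulrA; congr (_ * _).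
  by have := congr1 (@cl_tr R n) E; rewrite !cl_trM !cl_tr_clv.
have xTe : cl_even (cl_tr x * x) by apply/evenM/xe/even_tr.
have xTx : cl_tr x * x = (clc (cl_tr x * x) finset.set0)%:A.
  apply: clP => A; rewrite clc_scalar.
  have [->|/set0Pn[i iA]] := eqVneq A finset.set0; first by rewrite mulr1.
  rewrite mulr0; have [oA|eA] := boolP (odd #|A|); first exact: even_clc.
  by apply: comm_clA iA eA _; rewrite -clv_delta xTC.
move: xTx; set s := clc _ _ => xTx.
(* Conjugating the scalar [cl_tr x * x] by [x] gives the product in the other order. *)
have xxT : x * cl_tr x = s%:A.
  rewrite -[LHS](mulrK xU) -[x * _ * _]mulrA xTx -scalerAr mulr1 -scalerAl.
  by rewrite mulrV.
have N : spinor_norm x = s.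
  by rewrite /spinor_norm xxT clc_scalar eqxx mulr1.
rewrite -N in xTx xxT; have N0 : spinor_norm x != 0.
  apply/eqP => N0; move: xTx; rewrite N0 scale0r => /(congr1 (fun z => z * x^-1)).
  rewrite mul0r mulrK // => /(congr1 (@cl_tr R n)); rewrite cl_trK cl_tr0 => x0.
  by move: xU; rewrite x0 unitr0.
split=> //; rewrite -[LHS]mul1r; apply: (canLR (mulrK xU)).
by rewrite -scalerAl xTx scalerA mulVf // scale1r.
Qed.

Lemma spinor_normM x y : even_clifford x -> even_clifford y ->
  spinor_norm (x * y) = spinor_norm x * spinor_norm y.
Proof.
move=> /even_clifford_norm[xN _ _ _] /even_clifford_norm[yN _ _ _].
rewrite {1}/spinor_norm cl_trM mulrA -[x * y * _]mulrA yN -scalerAr mulr1 -scalerAl xN.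
by rewrite scalerA clc_scalar eqxx mulr1 mulrC.
Qed.

Lemma spinor_norm_eq x r : x * cl_tr x = r%:A -> spinor_norm x = r.
Proof. by rewrite /spinor_norm => ->; rewrite clc_scalar eqxx mulr1. Qed.

Lemma spinor_norm_clv2 u v : spinor_norm (clv u * clv v) = qform u * qform v.
Proof.
apply: spinor_norm_eq; rewrite cl_trM !cl_tr_clv mulrA -[clv u * clv v * _]mulrA.
by rewrite clv_sqr -scalerAr mulr1 -scalerAl clv_sqr scalerA mulrC.
Qed.

(* Conjugation by x is injective on V, hence onto. *)
Lemma even_clifford_conjV x : even_clifford x ->
  forall w, exists v, x * clv v = clv w * x.
Proof.
move=> [xe xU xV]; have [f fE] := choice xV.
pose M := \matrix_i f (delta_mx 0 i); have ME v : x * clv v = clv (v *m M) * x.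
  rewrite clv_mulmx mulr_suml [clv v]/clv mulr_sumr; apply: eq_bigr => i _.
  by rewrite rowK -scalerAl -fE -scalerAr clv_delta.
have Mfree : row_free M.
  apply: inj_row_free => v vM0; apply: clv_inj; rewrite clv0.
  by apply: (mulrI xU); rewrite ME vM0 clv0 mul0r mulr0.
move=> w; exists (w *m invmx M); rewrite ME mulmxKV //.
by rewrite -row_free_unit.
Qed.

Lemma even_cliffordV x : even_clifford x -> even_clifford x^-1.
Proof.
move=> xG; have [xe xU xV] := xG.
split=> [||w]; [exact: even_inv | by rewrite unitrV |].
have [v E] := even_clifford_conjV xG w.
by exists v; apply: (mulrI xU); rewrite mulrA mulrV // mul1r mulrA E mulrK.
Qed.

Lemma even_clifford_tr x : even_clifford x -> even_clifford (cl_tr x).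
Proof.
move=> xG; have [_ _ N0 xV] := even_clifford_norm xG.
have -> : cl_tr x = spinor_norm x *: x^-1.
  by rewrite xV scalerA mulfV // scale1r.
exact/even_cliffordZ/even_cliffordV.
Qed.

Lemma spinor_norm1 : spinor_norm 1 = 1.
Proof. by apply: spinor_norm_eq; rewrite cl_tr1 mulr1 scale1r. Qed.

Lemma spinor_norm_tr x : even_clifford x -> spinor_norm (cl_tr x) = spinor_norm x.
Proof.
move=> /even_clifford_norm[_ N _ _]; apply: spinor_norm_eq.
by rewrite cl_trK.
Qed.

End CliffordBasics.

(** * Angle cones and time orientation *)

Section AngleCones.
Variables (R : realType) (n : nat) (e : 'rV[R]_n).
Hypothesis he : qform e = 1.
Local Notation Cl := (Cl R n).
Local Notation E := (clv e).
Local Notation sigma := (sigma_e e).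
Implicit Types (x y z : Cl) (u v w : 'rV[R]_n) (r : R) (A : {set 'I_n}).

Lemma ee1 : E * E = 1.
Proof. by rewrite clv_sqr he scale1r. Qed.

Lemma mul_ee x : E * (E * x) = x.
Proof. by rewrite mulrA ee1 mul1r. Qed.

Lemma mulee x : x * E * E = x.
Proof. by rewrite -mulrA ee1 mulr1. Qed.

Lemma sigmaM x y : sigma (x * y) = sigma y * sigma x.
Proof. by rewrite /sigma_e cl_trM !mulrA mulee. Qed.

Lemma sigmaK : involutive sigma.
Proof. by move=> x; rewrite /sigma_e !cl_trM cl_trK !cl_tr_clv !mulrA ee1 mul1r mulee. Qed.

Lemma sigmaD x y : sigma (x + y) = sigma x + sigma y.
Proof. by rewrite /sigma_e cl_trD mulrDr mulrDl. Qed.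

Lemma sigmaZ r x : sigma (r *: x) = r *: sigma x.
Proof. by rewrite /sigma_e cl_trZ -scalerAr -scalerAl. Qed.

Lemma sigmaN x : sigma (- x) = - sigma x.
Proof. by rewrite -scaleN1r sigmaZ scaleN1r. Qed.

Lemma sigma1 : sigma 1 = 1.
Proof. by rewrite /sigma_e cl_tr1 mulr1 ee1. Qed.

Lemma sigma0 : sigma 0 = 0.
Proof. by rewrite /sigma_e cl_tr0 mulr0 mul0r. Qed.

Lemma sigma_unit x : x \is a GRing.unit -> sigma x \is a GRing.unit.
Proof.
move=> xU; apply/unitrP; exists (sigma x^-1).
by rewrite -!sigmaM mulVr // mulrV // sigma1.
Qed.

Lemma sigmaV x : sigma x^-1 = (sigma x)^-1.
Proof.
have [xU|xU] := boolP (x \is a GRing.unit).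
  apply: (mulIr (sigma_unit xU)).
  by rewrite -sigmaM mulrV // sigma1 mulVr ?sigma_unit.
rewrite invr_out // invr_out //; apply: contra xU => sU.
by rewrite -(sigmaK x) sigma_unit.
Qed.

Lemma even_conj x : cl_even x -> cl_even (E * x * E).
Proof. by move=> xe; rewrite /cl_even/= !cl_alphaM xe cl_alpha_clv !mulNr mulrN opprK. Qed.

Lemma conj_clv v : E * clv v * E = clv ((2 * bform e v) *: e - v).
Proof. by rewrite reflection_clv he scale1r. Qed.

Lemma even_clifford_conj x : even_clifford x -> even_clifford (E * x * E).
Proof.
move=> [xe xU xV]; split=> [||v]; first exact: even_conj.
  apply/unitrP; exists (E * x^-1 * E).
  by split; rewrite !mulrA mulee -[E * _ * _]mulrA ?mulVr ?mulrV // mulr1 ee1.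
have [w W] := xV ((2 * bform e v) *: e - v).
exists ((2 * bform e w) *: e - w); rewrite -conj_clv !mulrA mulee.
rewrite -[E * clv w * x]mulrA -W -conj_clv.
by rewrite !mulrA mulee.
Qed.

Lemma even_sigma x : cl_even x -> cl_even (sigma x).
Proof. by move=> xe; apply/even_conj/even_tr. Qed.

Lemma even_clifford_sigma x : even_clifford x -> even_clifford (sigma x).
Proof. by move=> xG; apply/even_clifford_conj/even_clifford_tr. Qed.

(** [cl_tr x] inverts [x] up to the norm. This form of the inverse serves to compute the action of
    the Levi factor on [W2n] and to prove [levi_mx] continuous. *)
Lemma sigma_invE x : even_clifford x ->
  (sigma x)^-1 = (spinor_norm x)^-1 *: (E * x * E).
Proof.
move=> /even_clifford_norm[N N' N0 _].
have sU : (spinor_norm x)^-1 *: (E * x * E) * sigma x = 1.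
  rewrite -scalerAl /sigma_e !mulrA mulee -[E * x * _]mulrA N -scalerAr mulr1.
  by rewrite -scalerAl ee1 scalerA mulVf // scale1r.
have sU' : sigma x \is a GRing.unit.
  apply/unitrP; exists ((spinor_norm x)^-1 *: (E * x * E)); split=> //.
  apply: (can_inj sigmaK); rewrite sigmaM sigmaK sigma1 sigmaZ -scalerAl.
  rewrite /sigma_e !cl_trM cl_tr_clv !mulrA ee1 mul1r mulee N'.
  by rewrite scalerA mulVf // scale1r.
by rewrite -[LHS]mul1r -sU mulrK.
Qed.

Lemma spinor_norm_conj x : even_clifford x -> spinor_norm (E * x * E) = spinor_norm x.
Proof.
move=> /even_clifford_norm[N _ _ _]; apply: spinor_norm_eq.
rewrite !cl_trM cl_tr_clv !mulrA mulee -[E * x * _]mulrA N -scalerAr mulr1.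
by rewrite -scalerAl ee1.
Qed.

Lemma spinor_norm_sigma x : even_clifford x -> spinor_norm (sigma x) = spinor_norm x.
Proof.
move=> xG; rewrite spinor_norm_conj ?spinor_norm_tr //.
exact: even_clifford_tr.
Qed.

Lemma spinor_norm_e v : spinor_norm (E * clv v) = qform v.
Proof. by rewrite spinor_norm_clv2 he mul1r. Qed.

Lemma eV_fixed z : eV e z -> sigma z = z.
Proof.
by move=> [v _ <-]; rewrite /sigma_e cl_trM !cl_tr_clv mulrA mulee.
Qed.

Lemma eVD y z : eV e y -> eV e z -> eV e (y + z).
Proof. by move=> [u _ <-] [v _ <-]; exists (u + v) => //; rewrite clvD mulrDr. Qed.

Lemma eVZ r z : eV e z -> eV e (r *: z).
Proof. by move=> [v _ <-]; exists (r *: v) => //; rewrite clvZ scalerAr. Qed.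

Lemma eVN z : eV e z -> eV e (- z).
Proof. by rewrite -scaleN1r; exact: eVZ. Qed.

Lemma eV_qform v : E * clv v \is a GRing.unit -> qform v != 0.
Proof.
move=> zU; apply: qform_unit; have -> : clv v = E * (E * clv v) by rewrite mul_ee.
by rewrite unitrMr //; apply/unitrP; exists E; rewrite ee1.
Qed.

Lemma eV_even_clifford z : eV e z -> z \is a GRing.unit -> even_clifford z.
Proof.
move=> [v _ <-] zU; apply: even_clifford_clv2; last exact: eV_qform.
by rewrite he oner_neq0.
Qed.

Lemma eV_invE v : E * clv v \is a GRing.unit ->
  (E * clv v)^-1 = E * clv ((qform v)^-1 *: ((2 * bform e v) *: e - v)).
Proof.
move=> zU; have q0 := eV_qform zU.
have H : E * clv ((qform v)^-1 *: ((2 * bform e v) *: e - v)) * (E * clv v) = 1.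
  rewrite clvZ -conj_clv -scalerAr -scalerAl !mulrA mulee ee1 mul1r.
  by rewrite clv_sqr scalerA mulVf // scale1r.
by rewrite -[LHS]mul1r -H mulrK.
Qed.

Lemma eVV z : eV e z -> z \is a GRing.unit -> eV e z^-1.
Proof. by move=> [v _ <-] zU; rewrite eV_invE //; eexists. Qed.

(** In terms of [v], twisting the angle [e v] by [x] is the map [v |-> g v g^T] with [g = e x e],
    which preserves the vectors when [x] is even Clifford. *)
Lemma twist_eV x v : x * (E * clv v) * sigma x =
  E * ((E * x * E) * clv v * cl_tr (E * x * E)).
Proof.
by rewrite /sigma_e !cl_trM cl_tr_clv !mulrA ee1 mul1r.
Qed.

Lemma clifford_actV x : even_clifford x ->
  forall v, exists w, x * clv v * cl_tr x = clv w.
Proof.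
move=> xG v; have [N _ _ _] := even_clifford_norm xG; have [_ _ xV] := xG.
have [w W] := xV v; exists (spinor_norm x *: w).
by rewrite W -mulrA N -scalerAr mulr1 clvZ.
Qed.

Lemma eV_twist x z : even_clifford x -> eV e z -> eV e (x * z * sigma x).
Proof.
move=> xG [v _ <-]; have [w W] := clifford_actV (even_clifford_conj xG) v.
by rewrite twist_eV W; exists w.
Qed.

(** The map [v |-> x v x^T] is the conjugation by [x], an isometry, times the norm of [x]. *)
Lemma clifford_act_bform x u v u' v' : even_clifford x ->
  x * clv u * cl_tr x = clv u' -> x * clv v * cl_tr x = clv v' ->
  bform u' v' = spinor_norm x ^+ 2 * bform u v.
Proof.
move=> xG U V; have [N N' _ _] := even_clifford_norm xG.
have P a b : x * clv a * cl_tr x * (x * clv b * cl_tr x) =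
    spinor_norm x *: (x * (clv a * clv b) * cl_tr x).
  rewrite !mulrA -[x * clv a * _ * _]mulrA N'.
  by rewrite -scalerAr mulr1 -!scalerAl.
apply: (@mulfI _ (2 : R)); first by rewrite pnatr_eq0.
apply: (@scalar_inj R n); rewrite -clvM -U -V !P -scalerDr -mulrDl -mulrDr clvM.
rewrite -scalerAr mulr1 -scalerAl N !scalerA; congr (_ *: _); ring.
Qed.

End AngleCones.

(** Having the same strict sign is transitive; time orientations are compared in this way. *)
Lemma mul_gt0_trans (R : realDomainType) (a b c : R) :
  0 < a * b -> 0 < b * c -> 0 < a * c.
Proof.
move=> ab bc; have b0 : b != 0 by apply: contraTneq ab => ->; rewrite mulr0 ltxx.
have := mulr_gt0 ab bc; have -> : a * b * (b * c) = a * c * b ^+ 2 by ring.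
by rewrite pmulr_lgt0 // exprn_even_gt0.
Qed.

(** * Time orientation under the Clifford group *)

Section Orientation.
Variables (R : realType) (n : nat).
Local Notation Cl := (Cl R n.+1).
Implicit Types (x y z : Cl) (u v w : 'rV[R]_n.+1) (r : R) (A : {set 'I_n.+1}).

Lemma qsign0 : qsign R (ord0 : 'I_n.+1) = 1. Proof. by []. Qed.
Lemma qsignS (i : 'I_n.+1) : i != ord0 -> qsign R i = -1.
Proof. by rewrite /qsign -val_eqE /= => /negbTE ->. Qed.

Lemma qform_le v : qform v <= v 0 ord0 ^+ 2.
Proof.
rewrite /qform /bform (bigD1 ord0) //= qsign0 mul1r expr2 gerDl.
by apply: sumr_le0 => i i0; rewrite qsignS // mulN1r oppr_le0 -expr2 sqr_ge0.
Qed.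

(* The combination v_0 u - u_0 v has no time component. *)
Lemma timelike_bform u v : 0 < qform u -> 0 < qform v ->
  0 < u 0 ord0 * v 0 ord0 * bform u v.
Proof.
move=> qu qv; have := qform_le (v 0 ord0 *: u - u 0 ord0 *: v).
rewrite qformD -scaleNr !qformZ bformZl bformZr !mxE.
have u0 : 0 < u 0 ord0 ^+ 2 by apply: lt_le_trans qu (qform_le u).
have v0 : 0 < v 0 ord0 ^+ 2 by apply: lt_le_trans qv (qform_le v).
have := mulr_gt0 u0 qv; have := mulr_gt0 v0 qu; nra.
Qed.

Lemma clsign_comm0 A :
  clsign R [set ord0]%SET A * clsign R A [set ord0]%SET = \prod_(i in A) qsign R i.
Proof.
rewrite /clsign big_set1; under [X in _ * X]eq_bigr do rewrite big_set1.
rewrite -big_split /=; apply: eq_bigr => j _; rewrite /swapsign [ord0 == j]eq_sym.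
have [->|j0] := eqVneq j ord0; first by rewrite ltnn /= qsign0 mulr1.
by rewrite lt0n ltn0 (_ : val j != 0%N) ?mul1r ?qsignS.
Qed.

Lemma conj_e0 x A : clc (clA R [set ord0]%SET * x * clA R [set ord0]%SET) A =
  clc x A * \prod_(i in A) qsign R i.
Proof.
have AE : symd (symd [set ord0]%SET A) [set ord0]%SET = A by rewrite symdC symdK.
rewrite -{1}AE clc_clAr clc_clAl -mulrA clsignDl; congr (_ * _).
rewrite [X in _ * (X * _)]/clsign !big_set1 /swapsign ltnn eqxx qsign0 mul1r.
exact: clsign_comm0.
Qed.

(** For each basis element [e_0 e_A e_0 e_A^T = 1], so that the scalar part is the sum of the
    squares of the coordinates of [x]. This positivity is what makes [v |-> x v x^T] preserve the
    time orientation. *)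
Lemma conj_e0_gt0 x : x != 0 ->
  0 < clc (clA R [set ord0]%SET * x * clA R [set ord0]%SET * cl_tr x) finset.set0.
Proof.
move=> x0; have -> : clc (clA R [set ord0]%SET * x * clA R [set ord0]%SET * cl_tr x)
    finset.set0 = \sum_A clc x A ^+ 2.
  rewrite clcM; apply: eq_bigr => A _; rewrite symd0 conj_e0 clc_tr -clsign_diag.
  set p := \prod_(i in A) _; have pp : p * p = 1.
    by rewrite /p -big_split big1 //= => i _; rewrite qsign_sqr.
  transitivity (clc x A ^+ 2 * (p * p) * (clsign R A A * clsign R A A)); first by ring.
  by rewrite pp clsign_sqr !mulr1.
rewrite lt_neqAle sumr_ge0 ?andbT => [|A _]; last exact: sqr_ge0.
apply: contra x0; rewrite eq_sym psumr_eq0 => [/allP xA|A _]; last exact: sqr_ge0.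
apply/eqP; apply: clP => A; have := xA A (mem_index_enum _).
by rewrite sqrf_eq0 => /eqP ->; rewrite /clc mxE.
Qed.

(** The time coordinate of [w] is the scalar part of [e_0 w = e_0 x e_0 x^T]. *)
Lemma clifford_act_e0 x w : even_clifford x ->
  x * clA R [set ord0]%SET * cl_tr x = clv w -> 0 < w 0 ord0.
Proof.
move=> [_ xU _] W; have x0 : x != 0 by apply: contraTneq xU => ->; rewrite unitr0.
have := conj_e0_gt0 x0; rewrite -!mulrA [x * _]mulrA W.
rewrite -{1}(symdd [set ord0]%SET) clc_clAl clc_clv.
by rewrite /clsign !big_set1 /swapsign ltnn eqxx qsign0 mulr1.
Qed.

(** The vector [t = x e_0 x^T], of positive time coordinate, serves as a reference: [bform w t] has
    the sign of [bform v e_0], the time coordinate of [v]. *)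
Lemma clifford_act_time x v w : even_clifford x -> 0 < qform v ->
  x * clv v * cl_tr x = clv w -> 0 < qform w /\ 0 < v 0 ord0 * w 0 ord0.
Proof.
move=> xG qv W; have [_ _ N0 _] := even_clifford_norm xG.
have N2 : 0 < spinor_norm x ^+ 2 by rewrite exprn_even_gt0.
have qw : 0 < qform w by rewrite /qform (clifford_act_bform xG W W) mulr_gt0.
split=> //; have [t T] := clifford_actV xG (delta_mx 0 ord0).
have := T; rewrite clv_delta => /clifford_act_e0 - /(_ xG) t0.
have q1 : qform (delta_mx 0 ord0 : 'rV[R]_n.+1) = 1.
  apply: (@scalar_inj R n.+1); rewrite -clv_sqr clv_delta clA_mul symdd.
  by rewrite /clsign !big_set1 /swapsign ltnn eqxx qsign0.
have qt : 0 < qform t by rewrite /qform (clifford_act_bform xG T T) -/(qform _) q1 mulr1.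
have Bv : bform v (delta_mx 0 ord0) = v 0 ord0.
  rewrite /bform (bigD1 ord0) //= qsign0 mxE eqxx mul1r mulr1 big1 ?addr0 // => i i0.
  by rewrite mxE (negbTE i0) andbF !mulr0.
have := timelike_bform qw qt; rewrite (clifford_act_bform xG W T) Bv.
set a := spinor_norm x ^+ 2 in N2 *.
have -> : w 0 ord0 * t 0 ord0 * (a * v 0 ord0) =
  (v 0 ord0 * w 0 ord0) * (t 0 ord0 * a) by ring.
by rewrite pmulr_lgt0 // mulr_gt0.
Qed.

End Orientation.

(** * Stability of the cone of positive angles *)

Section PositiveAngles.
Variables (R : realType) (n : nat) (e : 'rV[R]_n).
Hypothesis he : qform e = 1.
Local Notation Cl := (Cl R n).
Local Notation E := (clv e).
Local Notation sigma := (sigma_e e).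
Implicit Types (x y z : Cl) (u v w : 'rV[R]_n) (r : R).

(** By [timelike_bform], a vector of positive norm is in the cone of [e] when its time coordinate
    has the same sign as that of [e]. *)
Lemma clifford_act_Vpos x v w : even_clifford x -> Vpos e v ->
  x * clv v * cl_tr x = clv w -> Vpos e w.
Proof.
case: n e he x v w => [|m] f hf x v w xG [qv fv] W.
  (* In dimension 0 no vector has norm 1. *)
  by move: hf; rewrite /qform /bform big_ord0 => /esym/eqP; rewrite oner_eq0.
have [qw vw] := clifford_act_time xG qv W; split=> //.
have qf : 0 < qform f by rewrite hf.
have := timelike_bform qf qv; rewrite pmulr_lgt0 // => f_v.
by have := timelike_bform qf qw; rewrite pmulr_rgt0 // (mul_gt0_trans f_v).
Qed.

Lemma VposD u v : Vpos e u -> Vpos e v -> Vpos e (u + v).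
Proof.
case: n e he u v => [|m] f hf u v [qu fu] [qv fv].
  by move: hf; rewrite /qform /bform big_ord0 => /esym/eqP; rewrite oner_eq0.
have qf : 0 < qform f by rewrite hf.
have := timelike_bform qf qu; rewrite pmulr_lgt0 // => f_u.
have := timelike_bform qf qv; rewrite pmulr_lgt0 // => f_v.
have := timelike_bform qu qv; rewrite pmulr_rgt0; last first.
  by apply: mul_gt0_trans f_v; rewrite mulrC.
by move=> uv; split; rewrite ?bformDr ?addr_gt0 // qformD !addr_gt0 ?mulr_gt0.
Qed.

Lemma eVpos_eV z : eVpos e z -> eV e z.
Proof. by move=> [v _ <-]; exists v. Qed.

Lemma eVposD y z : eVpos e y -> eVpos e z -> eVpos e (y + z).
Proof.
move=> [u uV <-] [v vV <-]; exists (u + v); first exact: VposD.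
by rewrite clvD mulrDr.
Qed.

Lemma eVposZ r z : 0 < r -> eVpos e z -> eVpos e (r *: z).
Proof.
move=> r0 [v [qv ev] <-]; exists (r *: v); last by rewrite clvZ scalerAr.
by split; rewrite ?qformZ ?bformZr mulr_gt0 // exprn_gt0.
Qed.

Lemma eVpos_unit z : eVpos e z -> [/\ z \is a GRing.unit, even_clifford z & 0 < spinor_norm z].
Proof.
move=> [v [qv _] <-]; have G : even_clifford (E * clv v).
  by apply: even_clifford_clv2; rewrite ?he ?oner_neq0 // gt_eqF.
by split=> //; [case: G | rewrite spinor_norm_e].
Qed.

(** Up to the factor [(qform v)^-1], inversion replaces [v] by [e v e], which has the same norm and
    the same product with [e]. *)
Lemma eVposV z : eVpos e z -> eVpos e z^-1.
Proof.
move=> zV; have [zU _ _] := eVpos_unit zV; case: zV zU => v [qv ev] <- zU.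
rewrite eV_invE // clvZ -scalerAr; apply: eVposZ; first by rewrite invr_gt0.
exists ((2 * bform e v) *: e - v) => //; split.
  by rewrite qformD -scaleN1r !qformZ bformZl bformZr -/(qform e) he; nra.
by rewrite bformDr -scaleN1r !bformZr -/(qform e) he; lra.
Qed.

Lemma eVpos_twist x z : even_clifford x -> eVpos e z -> eVpos e (x * z * sigma x).
Proof.
move=> xG [v vV <-]; have G := even_clifford_conj he xG.
have [w W] := clifford_actV G v; rewrite twist_eV // W; exists w => //.
exact: clifford_act_Vpos G vV W.
Qed.

End PositiveAngles.

(** * Points of a polygon *)

(** Multiplying by the denominator reduces the claim to integers. It determines a homomorphism on
    the rational constants of the presentation. *)
Lemma additive_ratE (R : realType) (V : lmodType R) (f : {additive rat -> V}) q :
  f q = ratr q *: f 1.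
Proof.
have d0 : (denq q)%:~R != 0 :> R by rewrite intr_eq0 denq_neq0.
apply: (scalerI d0); rewrite scalerA -[X in _ * X]/((numq q)%:~R / (denq q)%:~R).
rewrite mulrCA mulfV // mulr1 !scaler_int -!raddfMz /=; congr (f _).
by rewrite -mulrzr numqE mulrC.
Qed.

Section PolygonPoints.
Variables (R : realType) (n : nat) (e : 'rV[R]_n).
Hypothesis he : qform e = 1.
Variable m : nat.
Local Notation Cl := (Cl R n).
Local Notation E := (clv e).
Local Notation sigma := (sigma_e e).
Implicit Types (i j k l : 'I_m) (X : 'I_m -> 'I_m -> Cl).
Implicit Types phi psi : {rmorphism B1 m -> Cl}.

(** Only the images of the [x_ij] are recorded, [tau] forcing those of the [y_ij]. The triangle
    relation is contained in the third clause, since [sigma] fixes the elements of [eV]. *)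
Definition polygon_data X : Prop :=
  [/\ forall i j, i != j -> even_clifford (X i j),
      forall i j, i != j -> X j i = sigma (X i j),
      forall i j k, i != j -> j != k -> k != i ->
        eV e ((X i j)^-1 * X i k * (X j k)^-1)
    & forall i j k l, cyclic4 i j k l ->
        X l j = X l k * (X i k)^-1 * X i j + X l i * (X k i)^-1 * X k j].

(** Compatibility with [tau] and [sigma] forces [y_ij |-> x_ji^T = e x_ij e]. *)
Definition letter_val X (c : letter) i j : Cl :=
  if c is LX then X i j else E * X i j * E.

Definition gen_val X (g : gen m) : Cl :=
  let: Gen c inv a := g in
  let x := letter_val X c (val a).1 (val a).2 in if inv then x^-1 else x.

Fixpoint term_val X (t : pterm (gen m)) : Cl :=
  match t with
  | PGen g => gen_val X g
  | PCst q => (ratr q)%:A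
  | PAdd s t => term_val X s + term_val X t
  | POpp s => - term_val X s
  | PMul s t => term_val X s * term_val X t
  end.

Lemma term_val_gterm X c inv i j : i != j ->
  term_val X (gterm c inv i j) =
  if inv then (letter_val X c i j)^-1 else letter_val X c i j.
Proof. by move=> ij; rewrite /gterm insubT. Qed.

Lemma conjM (x y : Cl) : E * (x * y) * E = (E * x * E) * (E * y * E).
Proof. by rewrite !mulrA mulee. Qed.

Lemma conj_tr (x : Cl) : E * x * E = cl_tr (sigma x).
Proof. by rewrite /sigma_e !cl_trM cl_tr_clv cl_trK mulrA. Qed.

Lemma conjV (x : Cl) : E * x^-1 * E = (E * x * E)^-1.
Proof.
have eU : E \is a GRing.unit by apply/unitrP; exists E; rewrite ee1.
have eV : E^-1 = E by rewrite -[LHS]mulr1 -(ee1 he) mulKr.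
have [xU|xU] := boolP (x \is a GRing.unit).
  by rewrite !invrM ?unitrMr ?eV ?mulrA // unitrMl.
rewrite !invr_out //; apply: contra xU => xU.
by rewrite -(unitrMr x eU) -(unitrMl (E * x) eU).
Qed.

Lemma conjD (x y : Cl) : E * (x + y) * E = E * x * E + E * y * E.
Proof. by rewrite mulrDr mulrDl. Qed.

Lemma letter_val_unit X c i j : (forall i j, i != j -> even_clifford (X i j)) ->
  i != j -> letter_val X c i j \is a GRing.unit.
Proof.
move=> XG ij; have := XG i j ij; case: c => [[]//|].
by move=> /(even_clifford_conj he)[].
Qed.

Lemma letter_val_sigma X c i j : (forall i j, i != j -> X j i = sigma (X i j)) ->
  i != j -> letter_val X c j i = sigma (letter_val X c i j).
Proof.
move=> Xs ij; case: c => /=; rewrite (Xs _ _ ij) //.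
have sE : sigma E = E by rewrite /sigma_e cl_tr_clv ee1 // mul1r.
by rewrite !sigmaM // sE mulrA.
Qed.

Lemma letter_val_swap X c i j : (forall i j, i != j -> X j i = sigma (X i j)) ->
  i != j -> letter_val X (swap_letter c) j i = cl_tr (letter_val X c i j).
Proof.
move=> Xs ij; case: c => /=; rewrite (Xs _ _ ij).
  by rewrite conj_tr sigmaK.
by rewrite !cl_trM cl_tr_clv mulrA.
Qed.

Lemma cyclic4_neq i j k l : cyclic4 i j k l ->
  [/\ [/\ l != j, i != k & l != k] & [/\ i != j, l != i, k != i & k != j]].
Proof.
by rewrite /cyclic4 -!val_eqE /= => H; split; split; apply/eqP => ?; move: H; lia.
Qed.

(** Conjugation by [e] is an automorphism of [Cl], so the relations in [y] follow from those in [x].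
    The element [x_ij y_ji] goes to the norm of [x_ij], a scalar and hence central. *)
Lemma term_val_rel X s t : polygon_data X -> B1_rel s t -> term_val X s = term_val X t.
Proof.
move=> [XG Xs Xa Xe]; have LU c i j := @letter_val_unit X c i j XG.
have norm i j : i != j -> letter_val X LX i j * letter_val X LY j i =
    (spinor_norm (X i j))%:A.
  move=> ij; rewrite -[LY]/(swap_letter LX) letter_val_swap //=.
  by have [] := even_clifford_norm (XG i j ij).
case=> {s t} [s t []{s t}|i j|i j t] /=.
- move=> c i j ij /=; rewrite !term_val_gterm //= mulVr ?LU //.
  by rewrite rmorph1 scale1r.
- move=> c i j ij /=; rewrite !term_val_gterm //= mulrV ?LU //.
  by rewrite rmorph1 scale1r.
- move=> c i j k ij jk ki /=.
  have [ji kj ik] : [/\ j != i, k != j & i != k].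
    by rewrite eq_sym ij eq_sym jk eq_sym ki.
  rewrite !(term_val_gterm X c _ ij, term_val_gterm X c _ jk, term_val_gterm X c _ ki,
    term_val_gterm X c _ ji, term_val_gterm X c _ kj, term_val_gterm X c _ ik) {LU norm}.
  (* The triangle relation is the invariance of an angle under [sigma]. *)
  have XE : (X k j)^-1 * X k i * (X j i)^-1 = (X i j)^-1 * X i k * (X j k)^-1.
    have := eV_fixed he (Xa i j k ij jk ki).
    by rewrite !(sigmaM he) !(sigmaV he) -(Xs _ _ ij) -(Xs _ _ jk) -(Xs _ _ ik) mulrA.
  case: c; rewrite /letter_val; first exact: XE.
  by rewrite -!conjV -!conjM XE.
- move=> c i j k l ijkl /=.
  have [[lj ik lk] [ij li ki kj]] := cyclic4_neq ijkl.
  have XE := Xe i j k l ijkl.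
  rewrite !(term_val_gterm X c _ lj, term_val_gterm X c _ ik, term_val_gterm X c _ lk,
    term_val_gterm X c _ ij, term_val_gterm X c _ li, term_val_gterm X c _ ki,
    term_val_gterm X c _ kj) {LU norm}.
  case: c; rewrite /letter_val; first exact: XE.
  by rewrite -!conjV -!conjM -conjD XE.
- move=> ij; have ji : j != i by rewrite eq_sym.
  rewrite !term_val_gterm // norm // -[LX in RHS]/(swap_letter LY) letter_val_swap //=.
  rewrite !cl_trM cl_tr_clv !mulrA mulee // -[E * _ * _]mulrA.
  have [-> _ _ _] := even_clifford_norm (XG i j ij).
  by rewrite -scalerAr -scalerAl mulr1 ee1.
- move=> ij; have ji : j != i by rewrite eq_sym.
  by rewrite !term_val_gterm // norm // -scalerAl -scalerAr mul1r mulr1.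
Qed.

Lemma term_val_cong X s t : polygon_data X -> pcong (@B1_rel m) s t ->
  term_val X s = term_val X t.
Proof.
move=> XP; elim=> {s t} /=.
- by move=> s t; exact: term_val_rel.
- by [].
- by [].
- by move=> s t u _ -> _ ->.
- by move=> s s' t t' _ -> _ ->.
- by move=> s s' _ ->.
- by move=> s s' t t' _ -> _ ->.
- by move=> s t u; rewrite addrA.
- by move=> s t; rewrite addrC.
- by move=> t; rewrite rmorph0 scale0r add0r.
- by move=> t; rewrite rmorph0 scale0r addNr.
- by move=> s t u; rewrite mulrA.
- by move=> t; rewrite rmorph1 scale1r mul1r.
- by move=> t; rewrite rmorph1 scale1r mulr1.
- by move=> s t u; rewrite mulrDl.
- by move=> s t u; rewrite mulrDr.
- by move=> a b; rewrite rmorphD scalerDl.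
- by move=> a b; rewrite rmorphM -[RHS]scalerAl mul1r scalerA.
- by move=> a t; rewrite -scalerAl -scalerAr mul1r mulr1.
Qed.

Lemma term_val_anti X (f : gen m -> gen m) (s : Cl -> Cl) t :
  (forall x y, s (x + y) = s x + s y) -> (forall x y, s (x * y) = s y * s x) ->
  (forall r x, s (r *: x) = r *: s x) -> s 1 = 1 ->
  (forall g, gen_val X (f g) = s (gen_val X g)) ->
  term_val X (pterm_rev f t) = s (term_val X t).
Proof.
move=> sD sM sZ s1 sg; elim: t => [g|q|a IHa b IHb|a IHa|a IHa b IHb] /=.
- exact: sg.
- by rewrite sZ s1.
- by rewrite IHa IHb sD.
- by rewrite IHa -scaleN1r -sZ scaleN1r.
- by rewrite IHa IHb sM.
Qed.

Lemma cl_trV (x : Cl) : cl_tr x^-1 = (cl_tr x)^-1.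
Proof.
have [xU|xU] := boolP (x \is a GRing.unit).
  have xtU : cl_tr x \is a GRing.unit.
    by apply/unitrP; exists (cl_tr x^-1); rewrite -!cl_trM mulVr // mulrV // cl_tr1.
  by apply: (mulIr xtU); rewrite -cl_trM mulrV // cl_tr1 mulVr.
rewrite !invr_out //; apply: contra xU => xU.
apply/unitrP; exists (cl_tr (cl_tr x)^-1).
by split; apply: (can_inj (@cl_trK R n)); rewrite cl_trM cl_trK cl_tr1 ?mulrV ?mulVr.
Qed.

Lemma point_y phi i j : Cl_point e phi -> phi (yB i j) = cl_tr (phi (xB j i)).
Proof. by move=> [_ pt _ _]; rewrite -pt B1_tau_x. Qed.

Lemma point_x_sym phi i j : Cl_point e phi -> phi (xB j i) = sigma (phi (xB i j)).
Proof. by move=> [ps _ _ _]; rewrite -ps B1_sigma_x. Qed.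

(** The image of [y_jk] is the transpose of that of [x_kj], which is the inverse times the norm.
    Canonical angles thus differ from those of [polygon_data] by a real factor, positive when the
    arcs have positive norm. *)
Lemma angle_val phi i j k : (forall a, phi (B1_tau a) = cl_tr (phi a)) ->
  even_clifford (phi (xB k j)) -> even_clifford (phi (xB j i)) ->
  phi (angle j k i) = (spinor_norm (phi (xB k j)) * spinor_norm (phi (xB j i))) *:
    ((phi (xB k j))^-1 * phi (xB k i) * (phi (xB j i))^-1).
Proof.
move=> phit /even_clifford_norm[_ _ N1 ->] /even_clifford_norm[_ _ N2 ->].
rewrite /angle !rmorphM /= -(B1_tau_x k j) -(B1_tau_x j i) !phit.
rewrite -!scalerAl -!scalerAr !scalerA; set a := _ * _ * _ : R.
by have -> : a = 1; [rewrite /a; field; apply/andP | rewrite scale1r].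
Qed.

Lemma polygon_data_point X : polygon_data X ->
  exists phi, [/\ Cl_point e phi, even_arcs phi
    & forall i j, i != j -> phi (xB i j) = X i j].
Proof.
move=> XP; have [XG Xs Xa Xe] := XP.
pose f (a : B1 m) : Cl := term_val X (prepr a).
(* The value does not depend on the chosen representative. *)
have fE t : f (pclass _ t) = term_val X t.
  exact/(term_val_cong XP)/prepr_class.
have fz : zmod_morphism f.
  move=> a b; rewrite -[a]preprK -[b]preprK -pclassN -pclassD !fE //=.
have fm : monoid_morphism f.
  split; first by rewrite -[1]/(pclass _ (PCst 1)) fE /= rmorph1 scale1r.
  by move=> a b; rewrite -[a]preprK -[b]preprK -pclassM !fE.
pose phi := HB.pack_for {rmorphism B1 m -> Cl} f
  (GRing.isZmodMorphism.Build _ _ f fz) (GRing.isMonoidMorphism.Build _ _ f fm).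
have phix i j : i != j -> phi (xB i j) = X i j.
  by move=> ij; rewrite [LHS]fE term_val_gterm.
have phis a : phi (B1_sigma a) = sigma (phi a).
  rewrite [LHS]fE; apply: term_val_anti.
  - exact: sigmaD.
  - exact: sigmaM.
  - exact: sigmaZ.
  - exact: sigma1.
  case=> c inv [[i j] ij] /=; rewrite (letter_val_sigma _ Xs ij).
  by case: inv; rewrite // sigmaV.
have phit a : phi (B1_tau a) = cl_tr (phi a).
  rewrite [LHS]fE; apply: term_val_anti.
  - exact: cl_trD.
  - exact: cl_trM.
  - exact: cl_trZ.
  - exact: cl_tr1.
  case=> c inv [[i j] ij] /=; rewrite (letter_val_swap _ Xs ij).
  by case: inv; rewrite // cl_trV.
have phiG i j : i != j -> even_clifford (phi (xB i j)).
  by move=> ij; rewrite phix //; exact: XG.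
exists phi; split=> //; last by move=> i j /phiG[].
split=> // [i j /phiG/even_cliffordP[]//|i j k ij jk ki].
have [ji kj ik] : [/\ j != i, k != j & i != k].
  by rewrite eq_sym ij eq_sym jk eq_sym ki.
by rewrite angle_val ?phix //; [apply/eVZ/Xa | exact: XG..].
Qed.

Lemma rmorph_cst phi q : phi (pclass _ (PCst q)) = (ratr q)%:A.
Proof.
pose f (a : rat) : Cl := phi (pclass _ (PCst a)).
have fD a b : f (a + b) = f a + f b.
  by rewrite /f -rmorphD -pclassD; congr (phi _); apply/pclassP/pcong_cstD.
have fz : zmod_morphism f.
  by move=> a b; apply: (addIr (f b)); rewrite -fD !subrK.
pose g := HB.pack_for {additive rat -> Cl} f (GRing.isZmodMorphism.Build _ _ f fz).
by rewrite -[LHS]/(g q) additive_ratE /= /f pclass1 rmorph1.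
Qed.

Lemma gterm_gen c inv (a : Defs.arc m) :
  gterm c inv (val a).1 (val a).2 = PGen (Gen c inv a).
Proof. by rewrite /gterm -surjective_pairing valK. Qed.

Lemma rmorph_inv phi c i j : i != j -> 
  phi (pclass _ (gterm c true i j)) = (phi (pclass _ (gterm c false i j)))^-1.
Proof.
move=> ij; have L : phi (pclass _ (gterm c true i j)) * phi (pclass _ (gterm c false i j)) = 1.
  rewrite -rmorphM -pclassM -(rmorph1 phi); congr (phi _).
  exact/pclassP/pcong_rel/B1_D2/D2_invl.
have U : phi (pclass _ (gterm c false i j)) \is a GRing.unit.
  apply/unitrP; exists (phi (pclass _ (gterm c true i j))); split=> //.
  rewrite -rmorphM -pclassM -(rmorph1 phi); congr (phi _).
  exact/pclassP/pcong_rel/B1_D2/D2_invr.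
by rewrite -[RHS]mul1r -L mulrK.
Qed.

(** The images of the [x_ij] determine those of the [y_ij] through [tau]; inverses and rational
    constants are respected by any homomorphism. *)
Lemma point_ext phi psi : (forall i j, i != j -> phi (xB i j) = psi (xB i j)) ->
  Cl_point e phi -> Cl_point e psi -> phi =1 psi.
Proof.
move=> xE phiP psiP a; rewrite -[a]preprK; elim: (prepr a) => {a}.
- case=> c inv a; rewrite -gterm_gen; case: a => -[i j] /= ij.
  have ji : j != i by rewrite eq_sym.
  suff uE : phi (pclass _ (gterm c false i j)) = psi (pclass _ (gterm c false i j)).
    by case: inv => //; rewrite !rmorph_inv // uE.
  case: c; first exact: xE.
  by rewrite -![pclass _ _]/(yB i j) !point_y // xE.
- by move=> q; rewrite !rmorph_cst.
- by move=> a IHa b IHb; rewrite pclassD !rmorphD IHa IHb.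
- by move=> a IHa; rewrite pclassN !rmorphN IHa.
- by move=> a IHa b IHb; rewrite pclassM !rmorphM IHa IHb.
Qed.

End PolygonPoints.

(** * Quadrilaterals *)

Lemma ord4P (i : 'I_4) : [\/ i = p1, i = p2, i = p3 | i = p4].
Proof.
case: i => [[|[|[|[|//]]]] i4]; [constructor 1|constructor 2|constructor 3|constructor 4];
exact: val_inj.
Qed.

(** Reversal and the exchange of the last two vertices generate the six orders of a triangle, and
    there are four triangles. *)
Lemma triples4 (P : 'I_4 -> 'I_4 -> 'I_4 -> Prop) :
  (forall i j k, i != j -> j != k -> k != i -> P i j k -> P k j i) ->
  (forall i j k, i != j -> j != k -> k != i -> P i j k -> P i k j) ->
  P p2 p1 p3 -> P p2 p1 p4 -> P p1 p3 p4 -> P p2 p3 p4 ->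
  forall i j k, i != j -> j != k -> k != i -> P i j k.
Proof.
move=> rev swap.
have all6 i j k : i != j -> j != k -> k != i -> P i j k ->
    P i j k /\ P k j i /\ P i k j /\ P k i j /\ P j k i /\ P j i k.
  move=> ij jk ki p; have [ji kj ik] : [/\ j != i, k != j & i != k].
    by rewrite eq_sym ij eq_sym jk eq_sym ki.
  have := rev _ _ _ ij jk ki p => q; have := swap _ _ _ ij jk ki p => r.
  have := swap _ _ _ kj ji ik q; have := rev _ _ _ ik kj ji r => s.
  by have := swap _ _ _ jk ki ij s.
move=> /all6 A /all6 B /all6 C /all6 D.
have {A} [A1 [A2 [A3 [A4 [A5 A6]]]]] := A isT isT isT.
have {B} [B1 [B2 [B3 [B4 [B5 B6]]]]] := B isT isT isT.
have {C} [C1 [C2 [C3 [C4 [C5 C6]]]]] := C isT isT isT.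
have {D} [D1 [D2 [D3 [D4 [D5 D6]]]]] := D isT isT isT.
move=> i j k.
by case: (ord4P i) => ->; case: (ord4P j) => ->; case: (ord4P k) => ->.
Qed.

(** The four cyclically ordered quadruples form two orbits under the half-turn. *)
Lemma cyclic4_ord4 (P : 'I_4 -> 'I_4 -> 'I_4 -> 'I_4 -> Prop) :
  (forall i j k l, cyclic4 i j k l -> P i j k l -> P k l i j) ->
  P p1 p2 p3 p4 -> P p2 p3 p4 p1 -> forall i j k l, cyclic4 i j k l -> P i j k l.
Proof.
move=> rot A B i j k l; have C := rot p1 p2 p3 p4 isT A; have D := rot p2 p3 p4 p1 isT B.
by case: (ord4P i) => ->; case: (ord4P j) => ->; case: (ord4P k) => ->;
  case: (ord4P l) => ->.
Qed.

Section Quadrilateral.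
Variables (R : realType) (n : nat) (e : 'rV[R]_n).
Hypothesis he : qform e = 1.
Local Notation Cl := (Cl R n).
Local Notation sigma := (sigma_e e).
Implicit Types (a b c d y z : Cl) (phi psi : {rmorphism B1 4 -> Cl}).

Lemma mx2M a b c d a' b' c' d' : mx2 a b c d *m mx2 a' b' c' d' =
  mx2 (a * a' + b * c') (a * b' + b * d') (c * a' + d * c') (c * b' + d * d').
Proof.
apply/matrixP => i j; rewrite !mxE big_ord_recl big_ord1 !mxE /=.
by case: (i == 0); case: (j == 0).
Qed.

Lemma mx2_inj a b c d a' b' c' d' : mx2 a b c d = mx2 a' b' c' d' ->
  [/\ a = a', b = b', c = c' & d = d'].
Proof.
move=> /matrixP M; have := M 0 0; have := M 0 1; have := M 1 0; have := M 1 1.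
by rewrite !mxE.
Qed.

Lemma mx2E (M : 'M[Cl]_2) : M = mx2 (M 0 0) (M 0 1) (M 1 0) (M 1 1).
Proof.
apply/matrixP => i j; rewrite !mxE.
by case: i => [[|[|//]] ?]; case: j => [[|[|//]] ?]; rewrite /=; congr (M _ _);
  apply: val_inj.
Qed.

Definition gauss_mx y a z : 'M[Cl]_2 :=
  mx2 1 0 y 1 *m mx2 a 0 0 (sigma a)^-1 *m mx2 1 z 0 1.

Lemma gauss_mxE y a z :
  gauss_mx y a z = mx2 a (a * z) (y * a) (y * a * z + (sigma a)^-1).
Proof.
by rewrite /gauss_mx !mx2M !(mul1r, mul0r, mulr1, mulr0, addr0, add0r).
Qed.

(** Vertices are counted from 0, so [a], [b], [c], [d] sit on the arcs 13, 14, 23, 24; the default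
    value 1 is the normalization of the arcs 12 and 34. *)
Definition quad_upper a b c d (i j : nat) : Cl :=
  match i, j with
  | 0, 2 => a | 0, 3 => b | 1, 2 => c | 1, 3 => d | _, _ => 1
  end.

Definition quad_arc a b c d (i j : 'I_4) : Cl :=
  if (i < j)%N then quad_upper a b c d i j else sigma (quad_upper a b c d j i).

(** Reversing an angle applies [sigma], which fixes it; exchanging its last two vertices inverts it
    and twists it by the inverse of an arc. The set [S] is a parameter in order to cover both [eV]
    and [eVpos]. *)
Lemma polygon_angles (X : 'I_4 -> 'I_4 -> Cl) (S : set Cl) :
  (forall i j, i != j -> even_clifford (X i j)) ->
  (forall i j, i != j -> X j i = sigma (X i j)) ->
  (forall w, S w -> eV e w) -> (forall w, S w -> w \is a GRing.unit -> S w^-1) ->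
  (forall x w, even_clifford x -> S w -> S (x * w * sigma x)) ->
  let P i j k := S ((X i j)^-1 * X i k * (X j k)^-1) in
  P p2 p1 p3 -> P p2 p1 p4 -> P p1 p3 p4 -> P p2 p3 p4 ->
  forall i j k, i != j -> j != k -> k != i -> P i j k.
Proof.
move=> XG Xs SV Sinv Stwist P; apply: triples4 => i j k ij jk ki Pijk.
- rewrite /P; suff <- : (X i j)^-1 * X i k * (X j k)^-1 =
    (X k j)^-1 * X k i * (X j i)^-1 by [].
  have ik : i != k by rewrite eq_sym.
  have := eV_fixed he (SV _ Pijk).
  rewrite !(sigmaM he) !(sigmaV he) -(Xs _ _ ij) -(Xs _ _ jk) -(Xs _ _ ik) mulrA.
  by move=> ->.
- have ik : i != k by rewrite eq_sym.
  have [_ ijU _] := XG _ _ ij; have [_ jkU _] := XG _ _ jk; have [_ ikU _] := XG _ _ ik.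
  set w := (X i j)^-1 * X i k * (X j k)^-1.
  have wU : w \is a GRing.unit by rewrite !unitrMl ?unitrV.
  rewrite /P; have -> : (X i k)^-1 * X i j * (X k j)^-1 =
      (X j k)^-1 * w^-1 * sigma (X j k)^-1.
    rewrite (sigmaV he) -(Xs _ _ jk); congr (_ * _).
    rewrite /w !invrM ?unitrMl ?unitrV // !invrK mulKr //.
  by apply: Stwist; [exact/even_cliffordV/XG | exact: Sinv].
Qed.

(** * The quadrilateral built from Gauss data *)

Section Data.
Variables (y a z : Cl).
Hypotheses (aG : even_clifford a) (yV : eV e y) (zV : eV e z)
  (yU : y \is a GRing.unit) (zU : z \is a GRing.unit).
Let y' := y + (sigma a)^-1 * z^-1 * a^-1.
Hypothesis y'U : y' \is a GRing.unit.
Let X := quad_arc a (a * z) (y * a) (y * a * z + (sigma a)^-1).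

Let aU : a \is a GRing.unit. Proof. by case: aG. Qed.
Let saU : sigma a \is a GRing.unit. Proof. exact: sigma_unit. Qed.

(** With [b = a * z], the element [y'] is [d * b^-1], the angle at 1 of the triangle 124. It is the
    sum of [y] and a twist of [z^-1], hence of the same kind as [y] and [z]. *)
Lemma quad_d : y * a * z + (sigma a)^-1 = y' * (a * z).
Proof. by rewrite /y' mulrDl !mulrA mulrVK // mulrVK. Qed.

Let y'E : y' = y + (sigma a)^-1 * z^-1 * sigma (sigma a)^-1.
Proof. by rewrite (sigmaV he) (sigmaK he). Qed.

Lemma quad_y'V : eV e y'.
Proof.
rewrite y'E; apply: eVD => //; apply: (eV_twist he); last exact: (eVV he).
exact/even_cliffordV/even_clifford_sigma.
Qed.

Lemma quad_arc_gamma i j : i != j -> even_clifford (X i j).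
Proof.
suff up k l : (k < l)%N -> even_clifford (quad_upper a (a * z) (y * a) (y * a * z + (sigma a)^-1) k l).
  move=> ij; rewrite /X /quad_arc; case: ltnP => [|ji]; first exact: up.
  by apply/even_clifford_sigma/up => //; rewrite ltn_neqAle ji andbT eq_sym.
have zG := eV_even_clifford he zV zU; have yG := eV_even_clifford he yV yU.
have dG : even_clifford (y * a * z + (sigma a)^-1).
  rewrite quad_d; apply: even_cliffordM; last exact: even_cliffordM.
  exact: (eV_even_clifford he quad_y'V).
case: k l => [|[|k]] [|[|[|[|l]]]] //= _; try exact: even_clifford1;
  by [exact: aG | exact: even_cliffordM | exact: dG].
Qed.

Lemma quad_arc_sigma i j : i != j -> X j i = sigma (X i j).
Proof.
rewrite -val_eqE /X /quad_arc /= => ij.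
by case: ltngtP ij => // _ _; rewrite (sigmaK he).
Qed.

Lemma quad_exchange i j k l : cyclic4 i j k l ->
  X l j = X l k * (X i k)^-1 * X i j + X l i * (X k i)^-1 * X k j.
Proof.
have s1 := sigma1 he.
move: i j k l; apply: cyclic4_ord4 => [i j k l ijkl E||].
(* Turning the quadruple by half a turn applies [sigma] to the relation. *)
- have [[lj ik lk] [ij li ki kj]] := cyclic4_neq ijkl.
  have := congr1 sigma E; rewrite sigmaD !(sigmaM he) !(sigmaV he).
  by rewrite -(quad_arc_sigma lj) -(quad_arc_sigma ij) -(quad_arc_sigma ik)
    -(quad_arc_sigma lk) -(quad_arc_sigma kj) -(quad_arc_sigma ki)
    -(quad_arc_sigma li) !mulrA.
- rewrite /X /quad_arc /= s1 mul1r mulr1.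
  rewrite sigmaD !(sigmaM he) (sigmaV he) (sigmaK he) (eV_fixed he yV) (eV_fixed he zV).
  by rewrite addrC (mulrK saU) mulrA.
(* The relation is [a = b d^-1 c + (sigma d)^-1]. Multiplied on the left by [y'], with [d = y' b],
   it is the definition of [y'] multiplied on the right by [a]. *)
- rewrite /X /quad_arc /= s1 mul1r mulr1 quad_d.
  have bU : a * z \is a GRing.unit by rewrite unitrMl.
  rewrite (invrM y'U bU) (mulVKr bU) [sigma (y' * _)](sigmaM he) (eV_fixed he quad_y'V).
  rewrite (invrM (sigma_unit he bU) y'U) -mulrDr; apply: (mulrI y'U).
  rewrite (mulVKr y'U) (sigmaM he) (eV_fixed he zV) (invrM zU saU) /y' mulrDl.
  by rewrite (mulrVK aU).
Qed.

(** One angle for each triangle is enough: these are [y], [y'], [z] and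
    [z + a^-1 y^-1 (sigma a)^-1]. *)
Lemma quad_angles (S : set Cl) :
  (forall w, S w -> eV e w) -> (forall w, S w -> w \is a GRing.unit -> S w^-1) ->
  (forall x w, even_clifford x -> S w -> S (x * w * sigma x)) ->
  (forall w w', S w -> S w' -> S (w + w')) -> S y -> S z ->
  forall i j k, i != j -> j != k -> k != i -> S ((X i j)^-1 * X i k * (X j k)^-1).
Proof.
move=> SV Sinv Stwist SD Sy Sz.
have saG : even_clifford (sigma a)^-1 by exact/even_cliffordV/even_clifford_sigma.
have Sy' : S y' by rewrite y'E; apply: SD Sy _; exact: Stwist (Sinv _ Sz zU).
have bU : a * z \is a GRing.unit by rewrite unitrMl.
apply: polygon_angles => //; first exact: quad_arc_gamma; first exact: quad_arc_sigma.
- by rewrite /X /quad_arc /= (sigma1 he) invr1 mul1r (mulrK aU).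
- by rewrite /X /quad_arc /= (sigma1 he) invr1 mul1r quad_d (mulrK bU).
- by rewrite /X /quad_arc /= invr1 mulr1 (mulKr aU).
- have yaU : y * a \is a GRing.unit by rewrite unitrMl.
  rewrite /X /quad_arc /= invr1 mulr1 mulrDr (mulKr yaU) (invrM yU aU) -(sigmaV he).
  by apply: SD Sz _; apply: Stwist (Sinv _ Sy yU); exact: even_cliffordV.
Qed.

Lemma quad_data : polygon_data e X.
Proof.
split; [exact: quad_arc_gamma | exact: quad_arc_sigma | | exact: quad_exchange].
apply: quad_angles => //.
- by move=> w; exact: eVV.
- by move=> x w; exact: eV_twist.
- by move=> w w'; exact: eVD.
Qed.

Lemma quad_arc_norm i j : 0 < spinor_norm a -> eVpos e y -> eVpos e z -> i != j ->
  0 < spinor_norm (X i j).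
Proof.
move=> a0 yP zP; have [_ yG y0] := eVpos_unit he yP; have [_ zG z0] := eVpos_unit he zP.
suff up k l : (k < l)%N ->
    0 < spinor_norm (quad_upper a (a * z) (y * a) (y * a * z + (sigma a)^-1) k l).
  move=> ij; have [ji|ij'] := ltnP j i; last first.
    by rewrite /X /quad_arc ltn_neqAle ij' andbT ij up // ltn_neqAle ij' andbT.
  rewrite quad_arc_sigma 1?eq_sym // (spinor_norm_sigma he).
    by rewrite /X /quad_arc ji up.
  by apply: quad_arc_gamma; rewrite eq_sym.
have y'P : eVpos e y'.
  rewrite y'E; apply: (eVposD he yP); apply: (eVpos_twist he); last exact: eVposV.
  exact/even_cliffordV/even_clifford_sigma.
have [_ y'G y'0] := eVpos_unit he y'P.
have azG : even_clifford (a * z) by exact: even_cliffordM.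
have d0 : 0 < spinor_norm (y * a * z + (sigma a)^-1).
  by rewrite quad_d !spinor_normM // !mulr_gt0.
case: k l => [|[|k]] [|[|[|[|l]]]] //= _; rewrite ?spinor_norm1 ?ltr01 //;
  by rewrite spinor_normM // mulr_gt0.
Qed.

End Data.
(** The unit conditions say that the entries of [gauss_mx e y a z] are units, as the images of arcs
    are. *)
Definition gauss_triple y a z : Prop :=
  [/\ even_clifford a, eV e y /\ y \is a GRing.unit, eV e z /\ z \is a GRing.unit
    & y * a * z + (sigma a)^-1 \is a GRing.unit].

Definition positive_triple y a z : Prop :=
  [/\ even_clifford a, 0 < spinor_norm a, eVpos e y & eVpos e z].

Lemma positive_norm_gt0 a : even_clifford a -> positive_norm a <-> 0 < spinor_norm a.
Proof.
move=> /even_clifford_norm[N _ _ _]; split=> [[r r0 /spinor_norm_eq ->//]|N0].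
by exists (spinor_norm a).
Qed.

Lemma gauss_point y a z : gauss_triple y a z -> exists phi,
  [/\ Cl_point e phi, normalized phi, even_arcs phi, point_mx e phi = gauss_mx y a z
    & positive_triple y a z -> positive_point e phi].
Proof.
move=> [aG [yV yU] [zV zU] dU]; have [_ aU _] := aG.
have y'U : y + (sigma a)^-1 * z^-1 * a^-1 \is a GRing.unit.
  by move: dU; rewrite quad_d // unitrMl // unitrMl.
pose X := quad_arc a (a * z) (y * a) (y * a * z + (sigma a)^-1).
have XP : polygon_data e X by exact: quad_data.
have [phi [phiP phie phiX]] := polygon_data_point he XP; exists phi; split=> //.
- by split; rewrite phiX.
- have -> : y = phi (xB p2 p3) * (phi (xB p1 p3))^-1.
    by rewrite !phiX // /X /quad_arc /= (mulrK aU).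
  have -> : z = (phi (xB p1 p3))^-1 * phi (xB p1 p4).
    by rewrite !phiX // /X /quad_arc /= (mulKr aU).
  by have -> : a = phi (xB p1 p3) by rewrite phiX.
move=> [_ a0 yP zP]; have XN i j : i != j -> 0 < spinor_norm (X i j).
  exact: quad_arc_norm.
have [XG _ _ _] := XP; split=> // [i j k ij jk ki|i j ij].
  have [ji kj ik] : [/\ j != i, k != j & i != k].
    by rewrite eq_sym ij eq_sym jk eq_sym ki.
  have [_ phit _ _] := phiP.
  rewrite (angle_val phit) ?phiX //; try exact: XG.
  apply: eVposZ; first by rewrite mulr_gt0 ?XN.
  apply: quad_angles => //; [exact: eVpos_eV| | |].
  - by move=> w wP _; exact: eVposV.
  - by move=> x w; exact: eVpos_twist.
  - by move=> w w'; exact: eVposD.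
by rewrite phiX //; apply/positive_norm_gt0; [exact: XG | exact: XN].
Qed.

(** * Gauss data of a point *)

Section PointGauss.
Variable phi : {rmorphism B1 4 -> Cl}.
Hypotheses (phiP : Cl_point e phi) (phi1 : normalized phi) (phie : even_arcs phi).
Local Notation x i j := (phi (xB i j)).

Lemma point_even_clifford (i j : 'I_4) : i != j -> even_clifford (x i j).
Proof. by move=> ij; apply/even_cliffordP; split; [case: phiP => _ _ + _; apply | exact: phie]. Qed.

(** This is the exchange relation for the quadruple 3, 4, 1, 2, in which [x_21] and [x_34] become 1
    and [x_31] is [sigma x_13]. *)
Lemma point_exchange : x p2 p4 = x p2 p3 * (x p1 p3)^-1 * x p1 p4 + (sigma (x p1 p3))^-1.
Proof.
have : xB p2 p4 = pclass _ (PAdd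
    (PMul (PMul (gterm LX false p2 p1) (gterm LX true p3 p1)) (gterm LX false p3 p4))
    (PMul (PMul (gterm LX false p2 p3) (gterm LX true p1 p3)) (gterm LX false p1 p4))).
  exact/pclassP/pcong_rel/B1_D2/D2_exchange.
move/(congr1 phi) ->; rewrite pclassD !pclassM rmorphD !rmorphM /=.
rewrite !rmorph_inv //.
rewrite -![phi (pclass _ (gterm LX false p2 p1))]/(x p2 p1)
  -![phi (pclass _ (gterm LX false p3 p1))]/(x p3 p1)
  -![phi (pclass _ (gterm LX false p3 p4))]/(x p3 p4).
rewrite (point_x_sym p1 p2 phiP) (point_x_sym p1 p3 phiP).
by have [-> ->] := phi1; rewrite (sigma1 he) mul1r mulr1 addrC.
Qed.

Lemma point_mxE : point_mx e phi = mx2 (x p1 p3) (x p1 p4) (x p2 p3) (x p2 p4).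
Proof.
have [_ aU _] := point_even_clifford (isT : p1 != p3).
rewrite /point_mx -/(gauss_mx _ _ _) gauss_mxE (mulVKr aU) (mulrVK aU) point_exchange.
by rewrite mulrA.
Qed.

(** [y] and [z] are the angles at 1 of the triangle 123 and at 3 of the triangle 134, divided by the
    norm of [x_13]. *)
Lemma point_gauss :
  let y := x p2 p3 * (x p1 p3)^-1 in let z := (x p1 p3)^-1 * x p1 p4 in
  [/\ gauss_triple y (x p1 p3) z, point_mx e phi = gauss_mx y (x p1 p3) z
    & positive_point e phi -> positive_triple y (x p1 p3) z].
Proof.
move=> y z; have G := point_even_clifford; have [_ phit _ phiA] := phiP.
have [_ aU _] := G p1 p3 isT; have [_ bU _] := G p1 p4 isT.
have [_ cU _] := G p2 p3 isT; have [_ dU _] := G p2 p4 isT.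
have [x12 x34] := phi1; have x21 : x p2 p1 = 1 by rewrite (point_x_sym p1 p2 phiP) x12 sigma1.
have yE : phi (angle p1 p2 p3) = spinor_norm (x p1 p3) *: y.
  rewrite (angle_val phit) ?x21 ?invr1 ?spinor_norm1 ?mul1r //.
    exact: even_clifford1.
  exact: G.
have zE : phi (angle p3 p1 p4) = spinor_norm (x p1 p3) *: z.
  have x43 : x p4 p3 = 1 by rewrite (point_x_sym p3 p4 phiP) x34 sigma1.
  rewrite (angle_val phit) ?x34 ?invr1 ?spinor_norm1 ?mulr1 //.
    exact: G.
  exact: even_clifford1.
have [_ _ N0 _] := even_clifford_norm (G p1 p3 isT).
have NK (w : Cl) : w = (spinor_norm (x p1 p3))^-1 *: (spinor_norm (x p1 p3) *: w).
  by rewrite scalerA mulVf // scale1r.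
split=> //.
  split; first exact: G.
  - split; last by rewrite unitrMl // unitrV.
    by rewrite (NK y); apply: eVZ; rewrite -yE; exact: phiA.
  - split; last by rewrite unitrMl // unitrV.
    by rewrite (NK z); apply: eVZ; rewrite -zE; exact: phiA.
  - by rewrite /y /z (mulrVK aU) mulrA -point_exchange.
move=> [_ angleP normP].
have a0 : 0 < spinor_norm (x p1 p3) by apply/(positive_norm_gt0 (G p1 p3 isT))/normP.
split=> //; first exact: G.
  by rewrite (NK y); apply: eVposZ; [rewrite invr_gt0 | rewrite -yE; exact: angleP].
by rewrite (NK z); apply: eVposZ; [rewrite invr_gt0 | rewrite -zE; exact: angleP].
Qed.

End PointGauss.

Lemma point_mx_inj phi psi : Cl_point e phi -> normalized phi -> even_arcs phi ->
  Cl_point e psi -> normalized psi -> even_arcs psi ->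
  point_mx e phi = point_mx e psi -> phi =1 psi.
Proof.
move=> phiP phi1 phie psiP psi1 psie.
rewrite !point_mxE // => /mx2_inj[E13 E14 E23 E24].
have [[f12 f34] [s12 s34]] := (phi1, psi1).
apply: (point_ext _ phiP psiP) => i j ij.
have up (k l : 'I_4) : (k < l)%N -> phi (xB k l) = psi (xB k l).
  by case: (ord4P k) => ->; case: (ord4P l) => -> // _; rewrite ?f12 ?s12 ?f34 ?s34.
have [ji|ij'] := ltnP j i; last first.
  by apply: up; rewrite ltn_neqAle ij' andbT.
by rewrite (point_x_sym j i phiP) (point_x_sym j i psiP) up.
Qed.

(** For positive data [y'] is a sum of two elements of [eVpos], hence a unit, and so is
    [d = y' a z]. *)
Lemma positive_triple_gauss y a z : positive_triple y a z -> gauss_triple y a z.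
Proof.
move=> [aG a0 yP zP]; have [yU _ _] := eVpos_unit he yP; have [zU _ _] := eVpos_unit he zP.
have [_ aU _] := aG; have yV := eVpos_eV yP; have zV := eVpos_eV zP.
split=> //; rewrite quad_d // unitrMl ?unitrMl //.
have wP : eVpos e ((sigma a)^-1 * z^-1 * sigma (sigma a)^-1).
  apply: (eVpos_twist he); last exact: eVposV.
  exact/even_cliffordV/even_clifford_sigma.
by have [] := eVpos_unit he (eVposD he yP wP); rewrite (sigmaV he) (sigmaK he).
Qed.

End Quadrilateral.

(** * Gauss decomposition in Spin(2,n) *)

Section RegularRepresentation.
Variables (R : realType) (n : nat).
Local Notation Cl := (Cl R n).
Implicit Types x y : Cl.

(** The matrix of right multiplication by [x]. Through it one-sided inverses are two-sided, and the
    units are the elements where a determinant does not vanish. *)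
Definition regular_mx x : 'M[R]_#|{: {set 'I_n}}| :=
  \matrix_i (clA R (enum_val i) * x : 'rV[R]_#|{: {set 'I_n}}|).

Lemma mulmx_regular x y : (y : 'rV_#|{: {set 'I_n}}|) *m regular_mx x = y * x.
Proof.
apply/rowP => j; rewrite mxE {2}(cl_decomp y) mulr_suml summxE.
rewrite (reindex _ (onW_bij _ (@enum_val_bij {set 'I_n}))) /=.
apply: eq_bigr => i _; rewrite -scalerAl /clc enum_valK [RHS]mxE.
by rewrite /regular_mx mxE.
Qed.

Lemma regular_mxM x y : regular_mx (x * y) = regular_mx x *m regular_mx y.
Proof.
by apply/row_matrixP => i; rewrite row_mul !rowK mulmx_regular mulrA.
Qed.

Lemma regular_mx1 : regular_mx 1 = 1%:M.
Proof.
by apply/row_matrixP => i; rewrite rowK mulr1 row1 /clA enum_valK.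
Qed.

Lemma mulr1_comm x y : x * y = 1 -> y * x = 1.
Proof.
move=> /(congr1 regular_mx); rewrite regular_mxM regular_mx1 => /mulmx1C.
rewrite -regular_mxM => yx1; have := mulmx_regular (y * x) 1.
by rewrite yx1 mulmx1 mul1r.
Qed.

Lemma unit_regular x : (x \is a GRing.unit) = (\det (regular_mx x) != 0).
Proof.
rewrite -unitfE -[RHS]/(regular_mx x \in unitmx); apply/idP/idP => [xU|rU].
  have := regular_mxM x x^-1; rewrite mulrV // regular_mx1 => /esym/mulmx1_unit.
  by case.
pose y : Cl := (1 : Cl) *m invmx (regular_mx x).
have yx : y * x = 1 by rewrite -mulmx_regular mulmxKV.
by apply/unitrP; exists y; split=> //; exact: mulr1_comm.
Qed.

End RegularRepresentation.

(** * The action of the spin group on the space of signature (2, n) *)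

Section SpinGroup.
Variables (R : realType) (n : nat) (e : 'rV[R]_n).
Hypothesis he : qform e = 1.
Local Notation Cl := (Cl R n).
Local Notation E := (clv e).
Local Notation sigma := (sigma_e e).
Implicit Types (a b c d x y z : Cl) (g h : 'M[Cl]_2) (u v w : 'rV[R]_n).

Lemma sigma_mx2 a b c d : (map_mx sigma (mx2 a b c d))^T =
  mx2 (sigma a) (sigma c) (sigma b) (sigma d).
Proof. by apply/matrixP => i j; rewrite !mxE; case: ifP; case: ifP. Qed.

Lemma Sp2_mx2P a b c d : Sp2 e (mx2 a b c d) <->
  [/\ sigma a * c = sigma c * a, sigma a * d - sigma c * b = 1
    & sigma b * d = sigma d * b].
Proof.
rewrite /Sp2/= sigma_mx2 !mx2M !(mulr0, mulr1, mulrN1, add0r, addr0) !mulNr.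
split=> [/mx2_inj[ac ad _ bd]|[ac ad bd]].
  split; last by apply/eqP; rewrite -subr_eq0 -bd addrC.
    by apply/eqP; rewrite -subr_eq0 -ac addrC.
  by rewrite -ad addrC.
rewrite ac bd !addNr addrC ad; congr mx2.
(* The remaining entry is minus the image of [ad] under [sigma]. *)
rewrite -[X in _ = - X](sigma1 he) -ad sigmaD (sigmaN e) (sigmaM he (sigma a) d).
by rewrite (sigmaM he (sigma c) b) !(sigmaK he) opprB addrC.
Qed.

Lemma mx2_even a b c d : (forall i j, cl_even (mx2 a b c d i j)) <->
  [/\ cl_even a, cl_even b, cl_even c & cl_even d].
Proof.
split=> [H|[ae be ce de] i j]; last by rewrite mxE; case: ifP; case: ifP.
have := H 0 0; have := H 0 1; have := H 1 0; have := H 1 1.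
by rewrite !mxE.
Qed.

Lemma Spin2nM g h : Spin2n e g -> Spin2n e h -> Spin2n e (g *m h).
Proof.
move=> [ge gS gW] [hh hS hW]; split=> [i j||s t v].
- rewrite mxE big_ord_recl big_ord1; apply: evenD; exact: evenM.
- have sM : (map_mx sigma (g *m h))^T = (map_mx sigma h)^T *m (map_mx sigma g)^T.
    rewrite (mx2E g) (mx2E h) mx2M !sigma_mx2 mx2M.
    by rewrite !sigmaD !(sigmaM he).
  have assoc (A B J C D : 'M[Cl]_2) :
    A *m B *m J *m (C *m D) = A *m (B *m J *m C) *m D by rewrite !mulmxA.
  by rewrite /Sp2/= sM assoc gS hS.
have [s1 [t1 [v1 H1]]] := hW s t v; have [s2 [t2 [v2 H2]]] := gW s1 t1 v1.
by exists s2, t2, v2; rewrite -mulmxA H1 mulmxA H2 mulmxA.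
Qed.

Lemma anticomm u v : clv v * clv u = (2 * bform u v)%:A - clv u * clv v.
Proof. by rewrite -clvM addrC addKr. Qed.

(** The action is an Eichler transvection: [s] is fixed, [v] moves by [- s u], and the change of [t]
    keeps [qform v + s * t] invariant. *)
Lemma lower_Spin2n y : eV e y -> Spin2n e (mx2 1 0 y 1).
Proof.
move=> yV; split; last 1 first.
- case: yV => u _ <- s t v.
  exists s, (t + 2 * bform u v - s * qform u), (v - s *: u).
  rewrite /W2n !mx2M !(mul1r, mul0r, mulr1, mulr0, addr0, add0r); congr mx2.
  + by rewrite clvD clvN clvZ -scalerAl mul_ee // subrK.
  + have vuE : E * clv (v - s *: u) * E * (E * clv u) =
        (2 * bform u v - s * qform u) *: E - E * clv u * clv v.
      rewrite mulrA mulee // -mulrA clvD clvN clvZ mulrBl (anticomm u v) -scalerAl clv_sqr.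
      rewrite scalerA !mulrBr -!scalerAr !mulr1 mulrA scalerBl.
      by rewrite addrAC.
    rewrite mulNr vuE opprB -addrA [(t + _) *: _]scalerDl -addrA addrC; congr (_ + _).
    by rewrite addrCA subrr addr0.
  + by rewrite clvD clvN clvZ mulrBr mulrBl opprB -scalerAr -scalerAr -scalerAl.
- apply/mx2_even; split; [exact: even1|exact: even0| |exact: even1].
  by case: yV => u _ <-; exact: even_clv2.
apply/Sp2_mx2P; rewrite (sigma1 he) (sigma0 e) (eV_fixed he yV).
by rewrite !(mul1r, mulr1, mul0r, mulr0, subr0).
Qed.

Lemma upper_Spin2n z : eV e z -> Spin2n e (mx2 1 z 0 1).
Proof.
move=> zV; split; last 1 first.
- case: zV => u _ <- s t v.
  (* For the opposite transvection the translation vector is [r = e u e], because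
     [z = e u = r e]. *)
  pose r := (2 * bform e u) *: e - u; have rE : clv r = E * clv u * E by rewrite conj_clv.
  have uE : clv u = E * clv r * E by rewrite rE !mulrA ee1 // mul1r mulee.
  exists (s - t * qform r - 2 * bform r v), t, (v + t *: r).
  rewrite /W2n !mx2M !(mul1r, mul0r, mulr1, mulr0, addr0, add0r); congr mx2.
  + by rewrite clvD clvZ rE -scalerAr.
  + have EU : E * clv u = clv r * E by rewrite rE mulee.
    have -> : clv (v + t *: r) * (E * clv u) =
        (2 * bform r v + t * qform r) *: E - clv r * clv v * E.
      rewrite EU mulrA clvD clvZ mulrDl (anticomm r v) -scalerAl clv_sqr scalerA.
      by rewrite mulrDl mulrBl -!scalerAl !mul1r scalerDl addrAC.
    rewrite EU mulrN !mulrA mulee // addrAC -scalerDl; congr (_ *: _ - _).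
    by ring.
  + rewrite clvD clvZ mulrDr mulrDl -scalerAl mul_ee // -scalerAr -scalerAl -uE.
    by rewrite opprD addrCA subrr addr0.
- apply/mx2_even; split; [exact: even1| |exact: even0|exact: even1].
  by case: zV => u _ <-; exact: even_clv2.
apply/Sp2_mx2P; rewrite (sigma1 he) (sigma0 e) (eV_fixed he zV).
by rewrite !(mul1r, mulr1, mul0r, mulr0, subr0).
Qed.

Definition levi_mx x : 'M[Cl]_2 := mx2 x 0 0 (sigma x)^-1.

Lemma levi_W2n x s t v w : even_clifford x -> x * clv v = clv w * x ->
  levi_mx x *m W2n e s t v = W2n e (spinor_norm x * s) ((spinor_norm x)^-1 * t) w *m levi_mx x.
Proof.
move=> xG xvw; have [_ _ N0 _] := even_clifford_norm xG.
rewrite /levi_mx /W2n !mx2M !(mul0r, mulr0, addr0, add0r) (sigma_invE he xG); congr mx2.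
- exact: xvw.
- by rewrite -!scalerAr -scalerAl scalerA mulKf // -mulrA mul_ee.
- by rewrite -!scalerAl -!scalerAr scalerA mulrC mulee.
- rewrite -!scalerAl -!scalerAr mulrN mulNr; congr (_ *: - _).
  by rewrite !mulrA !mulee // -[E * x * _]mulrA xvw !mulrA.
Qed.

Lemma levi_Spin2n x : even_clifford x -> Spin2n e (levi_mx x).
Proof.
move=> xG; have [xe xU xV] := xG; split=> [||s t v].
- by apply/mx2_even; split; [|exact: even0|exact: even0|apply/even_inv/even_sigma].
- apply/Sp2_mx2P; rewrite (sigma0 e) !(mulr0, mul0r, subr0) mulrV //.
  exact: sigma_unit.
by have [w xvw] := xV v; have := levi_W2n s t xG xvw; do 3!eexists; eassumption.
Qed.

Lemma gauss_Spin2n y a z : even_clifford a -> eV e y -> eV e z ->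
  Spin2n e (gauss_mx e y a z).
Proof.
move=> aG yV zV; apply: Spin2nM; last exact: upper_Spin2n.
by apply: Spin2nM; [exact: lower_Spin2n | exact: levi_Spin2n].
Qed.

Lemma upper_even_clifford a b d : a \is a GRing.unit ->
  Spin2n e (mx2 a b 0 d) -> even_clifford a.
Proof.
move=> aU [/mx2_even[ae _ _ _] _ gW]; split=> // v.
have [s [t [w]]] := gW 0 0 v; rewrite /W2n !mx2M => /mx2_inj[+ _ _ _].
by rewrite scale0r !mulr0 !addr0 => avw; exists w.
Qed.

(** The isotropic vector [W2n 1 0 0] goes to some [W2n s t v] with [v a + s e c = 0], which gives
    [c a^-1 = - s^-1 e v]. *)
Lemma Spin2n_ca_eV a b c d : a \is a GRing.unit ->
  Spin2n e (mx2 a b c d) -> eV e (c * a^-1).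
Proof.
move=> aU [_ _ gW]; have [s [t [v]]] := gW 1 0 0.
rewrite /W2n !mx2M clv0 !scale1r scale0r !(mulr0, mul0r, oppr0, add0r, addr0).
move=> /mx2_inj[ac aE _ _].
(* If [s] vanished, the first equation would give [v = 0] and the second then [a e = 0]. *)
have s0 : s != 0.
  apply/eqP => s0; move: ac aE; rewrite s0 scale0r !mul0r !addr0 => va0.
  have -> : clv v = 0 by apply: (mulIr aU); rewrite mul0r -va0.
  rewrite mul0r => /(congr1 ( *%R^~ E)); rewrite mulee // mul0r => a0.
  by move: aU; rewrite a0 unitr0.
exists (- s^-1 *: v) => //; apply: (canRL (mulrK aU)).
have := congr1 (fun w : Cl => - s^-1 *: (E * w)) ac; rewrite mulr0 scaler0 mulrDr.
rewrite -scalerAl -scalerAr mul_ee // scalerDr scalerA mulNr mulVf // scaleN1r.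
move=> /eqP; rewrite eq_sym subr_eq0 => /eqP <-.
by rewrite clvZ -scalerAr mulrA -!scalerAl.
Qed.

Lemma Spin2n_gauss a b c d : a \is a GRing.unit -> b \is a GRing.unit ->
  c \is a GRing.unit -> d \is a GRing.unit -> Spin2n e (mx2 a b c d) ->
  exists y z, gauss_triple e y a z /\ mx2 a b c d = gauss_mx e y a z.
Proof.
move=> aU bU cU dU gS; have yV := Spin2n_ca_eV aU gS.
set y := c * a^-1 in yV; have cE : c = y * a by rewrite mulrVK.
have [/mx2_even[ae be ce de] /Sp2_mx2P[ac ad _] _] := gS.
have saU := sigma_unit he aU.
have dE : d = y * b + (sigma a)^-1.
  apply: (mulrI saU); rewrite mulrDr mulrV // mulrA.
  have <- : sigma c = sigma a * y by rewrite cE (sigmaM he) (eV_fixed he yV).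
  by rewrite -ad addrCA subrr addr0.
(* The lower unipotent factor is peeled off. *)
have hS : Spin2n e (mx2 a b 0 (sigma a)^-1).
  have := Spin2nM (lower_Spin2n (eVN yV)) gS.
  rewrite mx2M !mul1r !mul0r !addr0 cE dE !mulNr addNr.
  by rewrite addrA addNr add0r.
have aG := upper_even_clifford aU hS.
pose z := a^-1 * b; have bE : b = a * z by rewrite mulVKr.
(* The Levi factor is peeled off. *)
have zS : Spin2n e (mx2 1 z 0 1).
  have := Spin2nM (levi_Spin2n (even_cliffordV aG)) hS.
  rewrite /levi_mx mx2M !(mulr0, mul0r, addr0, add0r) mulVr // (sigmaV he) invrK.
  by rewrite mulrV // -/z.
have zV : eV e z.
  (* The image of the isotropic vector [W2n 0 1 0] has component [v = z e], so that
     [z = e (e v e)]. *)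
  have [_ _ zW] := zS; have [s [t [v]]] := zW 0 1 0.
  rewrite /W2n !mx2M clv0 !scale1r scale0r !(mulr0, mul0r, mulr1, mul1r, oppr0, add0r, addr0).
  move=> /mx2_inj[zE _ _ _]; exists ((2 * bform e v) *: e - v) => //.
  by rewrite -conj_clv // !mulrA ee1 // mul1r -zE mulee.
exists y, z; split; last by rewrite gauss_mxE -[y * a * z]mulrA -bE -cE -dE.
split=> //; first by split=> //; rewrite unitrMl ?unitrV.
  by split=> //; rewrite unitrMl ?unitrV.
by rewrite -mulrA -bE -dE.
Qed.

Lemma levi_L_Theta x : even_clifford x -> L_Theta e (levi_mx x).
Proof.
move=> xG; have x0 : x * clv (0 : 'rV[R]_n) = clv (0 : 'rV[R]_n) * x by rewrite clv0 mulr0 mul0r.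
split; split; try exact: levi_Spin2n.
  exists (spinor_norm x); have := levi_W2n 1 0 xG x0.
  by rewrite !mulr0 scaler0.
exists (spinor_norm x)^-1; have := levi_W2n 0 1 xG x0.
by rewrite !mulr0 scaler0.
Qed.

(** Preserving the two isotropic lines forces [c = 0] and [b = 0]; the skew form then determines
    [d]. *)
Lemma L_Theta_levi g : L_Theta e g -> exists2 x, even_clifford x & g = levi_mx x.
Proof.
rewrite (mx2E g); move: (g 0 0) (g 0 1) (g 1 0) (g 1 1) => a b c d [[gS [k gk]] [_ [l gl]]].
have mulE0 x : x * E = 0 -> x = 0.
  by move=> /(congr1 ( *%R^~ E)); rewrite mulee // mul0r.
move: gk; rewrite /W2n !mx2M mulr0 scaler0 clv0 !scale0r
  !(mulr0, mul0r, oppr0, add0r, addr0) scale1r => /mx2_inj[_ _ _ /mulE0 c0].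
move: gl; rewrite /W2n !mx2M mulr0 scaler0 clv0 !scale0r
  !(mulr0, mul0r, oppr0, add0r, addr0) scale1r => /mx2_inj[/mulE0 b0 _ _ _].
move: gS; rewrite b0 c0 => gS; have [_ /Sp2_mx2P[_ + _] _] := gS.
rewrite mulr0 subr0 => ad; have da := mulr1_comm ad.
have saU : sigma a \is a GRing.unit by apply/unitrP; exists d.
have aU : a \is a GRing.unit by rewrite -(sigmaK he a) sigma_unit.
exists a; first exact: upper_even_clifford gS.
by congr mx2; apply: (mulrI saU); rewrite mulrV.
Qed.

End SpinGroup.

(** * Topology of the Clifford algebra *)

Lemma entry_continuous (T : topologicalType) m n (i : 'I_m) (j : 'I_n) :
  continuous (fun M : 'M[T]_(m, n) => M i j).
Proof.
move=> M S /= MS; exists (fun k l => if (k == i) && (l == j) then S else setT).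
  move=> k l; case: ifP => [/andP[/eqP -> /eqP ->]//|_]; exact: filterT.
by move=> N /(_ i j); rewrite /= !eqxx.
Qed.

Lemma entrywise_cvg (S T : topologicalType) m n (f : S -> 'M[T]_(m, n)) (s : S) :
  (forall i j, f t i j @[t --> s] --> f s i j) -> f t @[t --> s] --> f s.
Proof.
move=> fs A [P PA sPA]; have : \forall t \near s, forall i j, P i j (f t i j).
  by apply: filter_forall => i; apply: filter_forall => j; apply: fs; exact: PA.
by apply: filterS => t Pt; apply: sPA.
Qed.

Section CliffordTopology.
Variables (R : realType) (n : nat).
Local Notation Cl := (Cl R n).
Implicit Types (x y : Cl) (u v : 'rV[R]_n) (A : {set 'I_n}).

Lemma clc_continuous A : continuous (fun x => clc x A).
Proof. exact: coord_continuous. Qed.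

Lemma cl_cvg (T : topologicalType) (f : T -> Cl) (t : T) :
  (forall A, clc (f s) A @[s --> t] --> clc (f t) A) -> f s @[s --> t] --> f t.
Proof.
move=> H; apply: entrywise_cvg => i j; rewrite ord1.
by have := H (enum_val j); rewrite /clc enum_valK.
Qed.

Lemma clc_cvg (T : topologicalType) (f : T -> Cl) (t : T) A :
  f s @[s --> t] --> f t -> clc (f s) A @[s --> t] --> clc (f t) A.
Proof. by move=> ft; exact: (cvg_comp _ _ ft (@clc_continuous A (f t))). Qed.

Lemma coord_cvg (T : topologicalType) (f : T -> Cl) (t : T) j :
  f s @[s --> t] --> f t -> f s 0 j @[s --> t] --> f t 0 j.
Proof. by move=> ft; have := clc_cvg (A := enum_val j) ft; rewrite /clc enum_valK. Qed.

Lemma clM_cvg (T : topologicalType) (f g : T -> Cl) (t : T) :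
  f s @[s --> t] --> f t -> g s @[s --> t] --> g t ->
  f s * g s @[s --> t] --> f t * g t.
Proof.
move=> ft gt; apply: cl_cvg => A; rewrite clcM; under eq_fun do rewrite clcM.
apply: cvg_big; first exact: add_continuous.
move=> B _; apply: cvgM; last exact: cvg_cst.
by apply: cvgM; exact: clc_cvg.
Qed.

Lemma cl_tr_cvg (T : topologicalType) (f : T -> Cl) (t : T) :
  f s @[s --> t] --> f t -> cl_tr (f s) @[s --> t] --> cl_tr (f t).
Proof.
move=> ft; apply: cl_cvg => A; rewrite clc_tr; under eq_fun do rewrite clc_tr.
by apply: cvgM; [exact: cvg_cst | exact: clc_cvg].
Qed.

Lemma clZ_cvg (T : topologicalType) (r : T -> R) (f : T -> Cl) (t : T) :
  r s @[s --> t] --> r t -> f s @[s --> t] --> f t -> r s *: f s @[s --> t] --> r t *: f t.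
Proof.
move=> rt ft; apply: cl_cvg => A; rewrite clcZ; under eq_fun do rewrite clcZ.
by apply: cvgM => //; exact: clc_cvg.
Qed.

Lemma clD_cvg (T : topologicalType) (f g : T -> Cl) (t : T) :
  f s @[s --> t] --> f t -> g s @[s --> t] --> g t -> f s + g s @[s --> t] --> f t + g t.
Proof.
move=> ft gt; apply: cl_cvg => A; rewrite clcD; under eq_fun do rewrite clcD.
by apply: cvgD; exact: clc_cvg.
Qed.

Lemma cl_cst_cvg (T : topologicalType) (x : Cl) (t : T) : (fun=> x) s @[s --> t] --> x.
Proof. exact: cvg_cst. Qed.

Lemma spinor_norm_cvg (T : topologicalType) (f : T -> Cl) (t : T) :
  f s @[s --> t] --> f t -> spinor_norm (f s) @[s --> t] --> spinor_norm (f t).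
Proof.
move=> ft; apply: (@clc_cvg T (fun s => f s * cl_tr (f s)) t).
by apply: (clM_cvg ft); exact: cl_tr_cvg.
Qed.

Lemma spinor_norm_continuous : continuous (@spinor_norm R n).
Proof. by move=> x; apply: (@spinor_norm_cvg _ id); exact: cvg_id. Qed.

Lemma inv_spinor_norm_cvg (T : topologicalType) (f : T -> Cl) (t : T) :
  spinor_norm (f t) != 0 -> f s @[s --> t] --> f t ->
  (spinor_norm (f s))^-1 @[s --> t] --> (spinor_norm (f t))^-1.
Proof. by move=> N0 ft; apply: (cvgV N0); exact: spinor_norm_cvg. Qed.

Lemma det_regular_cvg (T : topologicalType) (f : T -> Cl) (t : T) :
  f s @[s --> t] --> f t -> \det (regular_mx (f s)) @[s --> t] --> \det (regular_mx (f t)).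
Proof.
move=> ft; rewrite /determinant; apply: cvg_big; first exact: add_continuous.
move=> s _; apply: cvgM; first exact: cvg_cst.
apply: cvg_big => [|i _]; first exact: mul_continuous.
rewrite mxE; under eq_fun do rewrite mxE.
apply: (@coord_cvg _ (fun s => clA R (enum_val i) * f s)).
by apply: (clM_cvg _ ft); exact: cl_cst_cvg.
Qed.

Lemma unit_open : open [set x : Cl | x \is a GRing.unit].
Proof.
have -> : [set x : Cl | x \is a GRing.unit] =
    (fun x => \det (regular_mx x)) @^-1` [set r | r != 0].
  by apply/seteqP; split=> x /=; rewrite unit_regular.
apply: open_comp; last exact: open_neq.
by move=> x _; apply: (@det_regular_cvg Cl id x); exact: cvg_id.
Qed.

Lemma unit_entries_open :
  open [set g : 'M[Cl]_2 | forall i j, g i j \is a GRing.unit].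
Proof.
rewrite openE => g gU /=.
have U : \forall h \near g, forall i j, (h : 'M[Cl]_2) i j \is a GRing.unit.
  apply: (filter_forall (F := nbhs g)) => i; apply: (filter_forall (F := nbhs g)) => j.
  have := @entry_continuous Cl 2 2 i j g [set x | x \is a GRing.unit]; apply.
  by apply: open_nbhs_nbhs; split; [exact: unit_open | exact: gU].
exact: U.
Qed.

End CliffordTopology.

(** * Connectedness of the spin group *)

Section SpinComponent.
Variables (R : realType) (n : nat).
Local Notation Cl := (Cl R n).
Implicit Types (x y h : Cl) (u v w : 'rV[R]_n) (r t : R).

Definition clifford_component : set Cl :=
  connected_component (@even_clifford R n) 1.

Lemma component_even_clifford x : clifford_component x -> even_clifford x.
Proof. exact: connected_component_sub. Qed.

Lemma clifford_component1 : clifford_component 1.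
Proof. exact/connected_component_refl/even_clifford1. Qed.

Lemma component_mull x : even_clifford x ->
  [/\ connected ( *%R x @` clifford_component), ( *%R x @` clifford_component) x
    & *%R x @` clifford_component `<=` @even_clifford R n].
Proof.
move=> xG; split.
- apply: connected_continuous_connected; first exact: component_connected.
  apply: continuous_subspaceT => y.
  by apply: (@clM_cvg _ _ _ (fun=> x) id y); [exact: cl_cst_cvg | exact: cvg_id].
- by exists 1; [exact: clifford_component1 | rewrite mulr1].
- by move=> _ [y /component_even_clifford yG <-]; exact: even_cliffordM.
Qed.

Lemma clifford_componentM x y :
  clifford_component x -> clifford_component y -> clifford_component (x * y).
Proof.
move=> xC yC; have xG := component_even_clifford xC.
have [Bc Bx BG] := component_mull xG.
apply: (connected_component_trans xC); exists ( *%R x @` clifford_component).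
  by split.
by exists y.
Qed.

Lemma clifford_componentV x : clifford_component x -> clifford_component x^-1.
Proof.
move=> xC; have xG := component_even_clifford xC; have [_ xU _] := xG.
have [Bc Bx BG] := component_mull (even_cliffordV xG).
exists ( *%R x^-1 @` clifford_component); last exact: Bx.
by split=> //; exists x => //; rewrite mulVr.
Qed.

(** The norm maps the component onto an interval that contains 1 and misses 0. *)
Lemma component_norm_gt0 x : clifford_component x -> 0 < spinor_norm x.
Proof.
move=> xC; rewrite ltNge; apply/negP => N0.
have : is_interval (@spinor_norm R n @` clifford_component).
  apply/connected_intervalP/connected_continuous_connected.
    exact: component_connected.
  exact/continuous_subspaceT/spinor_norm_continuous.
move=> /(_ (spinor_norm x) 1 _ _ 0)[].
- by exists x.
- by exists 1; [exact: clifford_component1 | exact: spinor_norm1].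
- by rewrite N0 ler01.
move=> y /component_even_clifford/even_clifford_norm[_ _ + _] y0.
by rewrite y0 eqxx.
Qed.

(** Multiplied by [u] and rescaled, the segment from [u] to [u + w] is a path starting at 1; the
    sign condition keeps it away from isotropic vectors, hence inside the group. *)
Lemma segment_component u w :
  (forall t, 0 <= t <= 1 -> 0 < qform u * qform (u + t *: w)) ->
  clifford_component ((qform u)^-1 *: (clv u * clv (u + w))).
Proof.
move=> uw; have qu : qform u != 0.
  have := uw 0; rewrite lexx ler01 scale0r addr0 => /(_ isT).
  by apply: contraTneq => ->; rewrite mul0r ltxx.
pose p t : Cl := (qform u)^-1 *: (clv u * clv (u + t *: w)).
have p0 : p 0 = 1.
  by rewrite /p scale0r addr0 clv_sqr scalerA mulVf // scale1r.
exists (p @` `[0, 1]); last first.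
  by exists 1; [rewrite /= in_itv /= ler01 lexx | rewrite /p scale1r].
split; first by exists 0 => //; rewrite /= in_itv /= ler01 lexx.
- move=> _ [t + <-]; rewrite /= in_itv /= => /uw uwt.
  apply: even_cliffordZ; first by rewrite invr_eq0.
  apply: even_clifford_clv2 => //; apply: contraTneq uwt => ->.
  by rewrite mulr0 ltxx.
apply: connected_continuous_connected; first exact: segment_connected.
apply: continuous_subspaceT => t.
have pE s : p s = 1 + s *: ((qform u)^-1 *: (clv u * clv w)).
  rewrite -p0 /p scale0r addr0 clvD clvZ mulrDr scalerDr -scalerAr !scalerA.
  by rewrite mulrC.
rewrite (_ : p = fun s => 1 + s *: ((qform u)^-1 *: (clv u * clv w))); last exact/funext.
apply: clD_cvg; first exact: cl_cst_cvg.
by apply: (@clZ_cvg R n R id _ t); [exact: cvg_id | exact: cl_cst_cvg].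
Qed.

(** Here [eps] is the common sign of the two norms, and [eps * qform (u + t *: v)] exceeds
    [(1 - t) ^+ 2] for [t > 0]. *)
Lemma pair_component (eps : R) u v : eps ^+ 2 = 1 -> qform u = eps -> qform v = eps ->
  -1 < eps * bform u v -> clifford_component (eps *: (clv u * clv (u + v))).
Proof.
move=> e2 qu qv uv; have -> : eps = (qform u)^-1.
  have e0 : eps != 0 by apply: contra_eq_neq e2 => ->; rewrite expr0n /= eq_sym oner_neq0.
  by rewrite qu; apply: (mulfI e0); rewrite mulfV // -e2.
apply: segment_component => t /andP[t0 t1]; rewrite qformD qformZ bformZr qu qv.
rewrite (_ : _ * _ = eps ^+ 2 * (1 + t ^+ 2) + 2 * t * (eps * bform u v)); last by ring.
rewrite e2; move: t0; rewrite le_eqVlt => /predU1P[<-|t0]; first by nra.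
have := mulr_gt0 t0 (_ : 0 < eps * bform u v + 1).
by rewrite -ltrBlDr sub0r => /(_ uv); have := sqr_ge0 (1 - t); nra.
Qed.

(** The segment runs through the positive multiples of [u], from [u] to [r *: u]. *)
Lemma scalar_component u r : qform u != 0 -> 0 < r -> clifford_component (r%:A).
Proof.
move=> qu r0; have -> : r%:A = (qform u)^-1 *: (clv u * clv (u + (r - 1) *: u)).
  rewrite scalerBl scale1r addrCA subrr addr0 clvZ -scalerAr clv_sqr !scalerA.
  by rewrite mulrAC mulVf // mul1r.
apply: segment_component => t /andP[t0 t1].
have -> : u + t *: ((r - 1) *: u) = (1 + t * (r - 1)) *: u.
  by rewrite scalerDl scale1r scalerA.
rewrite qformZ mulrCA -expr2.
rewrite mulr_gt0 ?exprn_even_gt0 //=.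
have : 0 < 1 + t * (r - 1) by nra.
by move/lt0r_neq0.
Qed.

Lemma conj_bform x v v' w w' : x \is a GRing.unit ->
  x * clv v = clv w * x -> x * clv v' = clv w' * x -> bform w w' = bform v v'.
Proof.
move=> xU W W'; apply: (@mulfI _ (2 : R)); first by rewrite pnatr_eq0.
apply: (@scalar_inj R n); apply: (mulIr xU); rewrite -!clvM.
transitivity (x * (clv v * clv v' + clv v' * clv v)); last first.
  by rewrite clvM -scalerAl -scalerAr mul1r mulr1.
by rewrite mulrDr mulrDl !mulrA W W' -!mulrA W W'.
Qed.

Lemma orthogonal_anticomm u v : bform u v = 0 -> clv u * clv v = - (clv v * clv u).
Proof. by move=> uv; apply/eqP; rewrite -addr_eq0 clvM uv mulr0 scale0r. Qed.

Lemma anticomm_comm u v w : bform u v = 0 -> bform u w = 0 ->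
  clv u * (clv v * clv w) = clv v * clv w * clv u.
Proof.
move=> uv uw; rewrite mulrA (orthogonal_anticomm uv) mulNr -[LHS]mulNr -mulNr.
by rewrite -!mulrA (orthogonal_anticomm uw) mulrN mulNr opprK.
Qed.

End SpinComponent.

(** * Reduction to scalars in dimension at least three *)

Section SpinConnected.
Variables (R : realType) (m : nat).
Local Notation Cl := (Cl R m.+3).
Local Notation b := (fun i : 'I_m.+3 => delta_mx 0 i : 'rV[R]_m.+3).
Implicit Types (x y h : Cl) (u v w : 'rV[R]_m.+3) (i k : 'I_m.+3).

Lemma bform_delta v i : bform v (b i) = qsign R i * v 0 i.
Proof.
rewrite /bform (bigD1 i) //= mxE !eqxx mulr1 big1 ?addr0 // => j /negbTE ji.
by rewrite mxE ji andbF !mulr0.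
Qed.

Lemma spacelike_qform v : v 0 ord0 = 0 -> qform v <= 0 /\ (qform v = 0 -> v = 0).
Proof.
move=> v0; have qE : qform v = - \sum_i v 0 i ^+ 2.
  rewrite /qform /bform -sumrN; apply: eq_bigr => i _.
  have [->|i0] := eqVneq i ord0; first by rewrite v0 expr0n mulr0 mulr0 oppr0.
  by rewrite qsignS // mulN1r expr2.
split; first by rewrite qE oppr_le0; apply: sumr_ge0 => i _; exact: sqr_ge0.
move/eqP; rewrite qE oppr_eq0 psumr_eq0 => [/allP vi|i _]; last exact: sqr_ge0.
by apply/rowP => i; rewrite mxE; have := vi i (mem_index_enum _); rewrite sqrf_eq0 => /eqP.
Qed.

Lemma qform_delta i : qform (b i) = qsign R i.
Proof. by rewrite /qform bform_delta mxE !eqxx mulr1. Qed.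

Lemma bform_delta_neq i k : i != k -> bform (b i) (b k) = 0.
Proof. by move=> ik; rewrite bform_delta mxE eq_sym (negbTE ik) andbF mulr0. Qed.

(* Half a turn is a square: (1 - b_i b_k)^2 = - 2 b_i b_k. *)
Lemma rotation_component i k : i != ord0 -> k != ord0 -> i != k ->
  clifford_component (- 2 *: (clv (b i) * clv (b k))).
Proof.
move=> i0 k0 ik; have C : clifford_component (-1 *: (clv (b i) * clv (b i + b k))).
  apply: pair_component; rewrite ?qform_delta ?qsignS // ?sqrrN ?expr1n //.
  by rewrite bform_delta_neq // mulr0 ltrN10.
have := clifford_componentM C C; congr clifford_component.
set u := clv (b i); set v := clv (b k).
have uu : u * u = -1 by rewrite /u clv_sqr qform_delta qsignS // scaleN1r.
have vv : v * v = -1 by rewrite /v clv_sqr qform_delta qsignS // scaleN1r.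
have vu : v * u = - (u * v).
  by apply: orthogonal_anticomm; rewrite bform_delta_neq // eq_sym.
have uvuv : u * v * (u * v) = -1.
  by rewrite mulrA -[u * v * u]mulrA vu mulrN mulrA uu mulN1r opprK vv.
rewrite clvD mulrDr uu !scaleN1r opprD opprK mulrBr mulr1 mulrBl mul1r uvuv.
by rewrite opprB addrACA subrr add0r -opprD scaleNr scaler_nat mulr2n.
Qed.

(** The square of [- 2 b_i b_k] is [- 4], which is rescaled by [4^-1]. Two distinct spacelike basis
    vectors exist as the dimension is at least 3. *)
Lemma minus1_component : clifford_component (-1 : Cl).
Proof.
pose i : 'I_m.+3 := inord 1; pose k : 'I_m.+3 := inord 2.
have [i0 k0 ik] : [/\ i != ord0, k != ord0 & i != k].
  by rewrite -!val_eqE /= !inordK.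
have C := rotation_component i0 k0 ik; have := clifford_componentM C C.
have q0 : qform (b i) != 0 by rewrite qform_delta qsignS // oppr_eq0 oner_eq0.
move=> /(clifford_componentM (scalar_component q0 (_ : 0 < 4^-1))).
rewrite invr_gt0 ltr0n => /(_ isT); congr clifford_component.
set u := clv (b i); set v := clv (b k).
have uvuv : u * v * (u * v) = -1.
  rewrite mulrA -[u * v * u]mulrA [v * u]orthogonal_anticomm; last first.
    by rewrite bform_delta_neq // eq_sym.
  rewrite mulrN mulrA /u clv_sqr qform_delta qsignS // scaleN1r mulN1r opprK.
  by rewrite /v clv_sqr qform_delta qsignS // scaleN1r.
rewrite -scalerAl -scalerAr mul1r -scalerAl uvuv !scalerA.
have -> : 4^-1 * -2 * -2 = 1 :> R by field.
by rewrite scale1r.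
Qed.

(* If x takes b_k to w <> - b_k, the product b_k (b_k + w) takes w back to b_k;
   if w = - b_k, then b_k b_(k+1) does. *)
Lemma fix_basis_vectors x (k : nat) : even_clifford x -> 0 < spinor_norm x ->
  (k < m.+3)%N -> exists2 h, clifford_component h &
  forall i : 'I_m.+3, (i < k)%N -> clv (b i) * (h * x) = h * x * clv (b i).
Proof.
move=> xG x0; elim: k => [|k IHk] km; first by exists 1 => //; exact: clifford_component1.
have [h hC hfix] := IHk (ltnW km).
have hG := component_even_clifford hC.
have h0 := component_norm_gt0 hC.
have yG : even_clifford (h * x) by exact: even_cliffordM.
have y0 : 0 < spinor_norm (h * x) by rewrite spinor_normM // mulr_gt0.
suff [g gC gfix] : exists2 g, clifford_component g & forall i : 'I_m.+3,
    (i <= k)%N -> clv (b i) * (g * (h * x)) = g * (h * x) * clv (b i).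
  exists (g * h); first exact: clifford_componentM.
  by move=> i ik; rewrite -[g * h * x]mulrA; exact: gfix.
move: (h * x) yG y0 hfix => {IHk h hC hG h0 x xG x0} x xG x0 xfix.
have [_ xU xV] := xG; pose kk : 'I_m.+3 := inord k.
have kkE : kk = k :> nat by rewrite inordK // ltnW.
have [w W] := xV (b kk).
(* The action of [x] is isometric and fixes the earlier [b_i], so [w] is orthogonal to them. *)
have wb (i : 'I_m.+3) : (i < k)%N -> bform (b i) w = 0.
  move=> ik; rewrite (conj_bform xU (esym (xfix i ik)) W) bform_delta_neq //.
  by rewrite -val_eqE /= kkE ltn_eqF.
have bb (i : 'I_m.+3) : (i < k)%N -> bform (b i) (b kk) = 0.
  by move=> ik; rewrite bform_delta_neq // -val_eqE /= kkE ltn_eqF.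
have qw : qform w = qsign R kk by rewrite /qform (conj_bform xU W W) -/(qform _) qform_delta.
(* It suffices to take [w] back to [b_k] by an element that commutes with the earlier basis
   vectors. *)
have step g : clifford_component g ->
    (forall i : 'I_m.+3, (i < k)%N -> clv (b i) * g = g * clv (b i)) ->
    g * clv w = clv (b kk) * g -> exists2 g, clifford_component g &
    forall i : 'I_m.+3, (i <= k)%N -> clv (b i) * (g * x) = g * x * clv (b i).
  move=> gC gfix gw; exists g => // i; rewrite leq_eqVlt => /predU1P[ik|ik].
    have -> : i = kk by apply: val_inj; rewrite /= kkE.
    by rewrite -[g * x * _]mulrA W !mulrA gw.
  by rewrite mulrA gfix // -!mulrA xfix.
have qs2 : qsign R kk ^+ 2 = 1 by rewrite expr2 qsign_sqr.
have generic : -1 < qsign R kk * bform (b kk) w -> exists2 g, clifford_component g &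
    forall i : 'I_m.+3, (i <= k)%N -> clv (b i) * (g * x) = g * x * clv (b i).
  move=> Bw; apply: step (pair_component qs2 (qform_delta kk) qw Bw) _ _.
    move=> i ik; rewrite -scalerAl -scalerAr anticomm_comm ?bb //.
    by rewrite bformDr bb // wb // addr0.
  rewrite -scalerAl -scalerAr; congr (_ *: _).
  rewrite -mulrA clvD mulrDl (clv_sqr w) qw -(qform_delta kk) -clv_sqr mulrDr.
  by rewrite [in RHS]mulrDr mulrDr addrC.
case: (posnP k) => [k0|k0].
  (* For the time vector the exceptional case does not occur: as the norm of [x] is positive, [w]
     has positive time coordinate. *)
  apply: generic; have kk0 : kk = ord0 by apply: val_inj; rewrite /= kkE k0.
  rewrite kk0 qsign0 mul1r bformC bform_delta qsign0 mul1r.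
  have N0 := x0; have [N _ _ _] := even_clifford_norm xG.
  have xwT : x * clA R [set ord0]%SET * cl_tr x = clv (spinor_norm x *: w).
    by rewrite -clv_delta -kk0 W -mulrA N -scalerAr mulr1 clvZ.
  have := clifford_act_e0 xG xwT; rewrite mxE pmulr_rgt0 // => w0.
  by apply: lt_trans w0; rewrite oppr_lt0.
have kk0 : kk != ord0 by rewrite -val_eqE /= kkE -lt0n.
(* [w + b_k] is orthogonal to [b_0], so its norm is at most 0. This bounds [bform w (b_k)] by 1,
   with equality only for [w = - b_k]. *)
have w0 : (w + b kk) 0 ord0 = 0.
  have := wb ord0 k0; rewrite bformC bform_delta qsign0 mul1r !mxE => ->.
  by rewrite add0r eqxx eq_sym (negbTE kk0).
have [] := spacelike_qform w0.
rewrite qformD qw qform_delta qsignS // => qle q0.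
have [Bw|Bw] := eqVneq (bform w (b kk)) 1; last first.
  apply: generic; rewrite qsignS // mulN1r ltrN2 bformC lt_neqAle Bw /=.
  by lra.
have wE : w = - b kk by apply/eqP; rewrite -addr_eq0 q0 // Bw; lra.
(* The index [k + 1] exists because the induction stops before the last basis vector. *)
pose k1 : 'I_m.+3 := inord k.+1; have k1E : k1 = k.+1 :> nat by rewrite inordK.
have k10 : k1 != ord0 by rewrite -val_eqE /= k1E.
have kk1 : kk != k1 by rewrite -val_eqE /= kkE k1E; lia.
apply: step (rotation_component kk0 k10 kk1) _ _.
  move=> i ik; rewrite -scalerAl -scalerAr anticomm_comm ?bb //.
  by rewrite bform_delta_neq // -val_eqE /= k1E; lia.
rewrite wE clvN -scalerAl -scalerAr; congr (_ *: _).
rewrite mulrN -mulrA [clv (b k1) * _]orthogonal_anticomm ?mulrN ?opprK //.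
by rewrite bform_delta_neq // eq_sym.
Qed.

(** Once all basis vectors but the last are fixed, [even_comm_scalar] makes [h * x] a scalar; a
    negative one is reached through [-1]. *)
Lemma even_clifford_connected x :
  even_clifford x -> 0 < spinor_norm x -> clifford_component x.
Proof.
move=> xG x0; have [h hC hfix] := fix_basis_vectors xG x0 (ltnSn m.+2).
have hG := component_even_clifford hC; have [_ hU _] := hG.
have [hxe hxU _] : even_clifford (h * x) by exact: even_cliffordM.
suff hxC : clifford_component (h * x).
  by rewrite -(mulKr hU x); apply: clifford_componentM => //; exact: clifford_componentV.
have hxE : h * x = (clc (h * x) finset.set0)%:A.
  apply: (@even_comm_scalar _ _ ord_max) => // i im.
  have := hfix i; rewrite clv_delta; apply.
  by rewrite ltn_neqAle -ltnS ltn_ord andbT -val_eqE in im *.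
have q0 : qform (b ord0) != 0 by rewrite qform_delta qsign0 oner_neq0.
move: hxE; set r := clc _ _ => hxE.
have [r0|r0|r0] := ltgtP r 0.
- rewrite hxE -[r]opprK scaleNr -mulN1r; apply: clifford_componentM.
    exact: minus1_component.
  by apply: scalar_component q0 _; rewrite oppr_gt0.
- by rewrite hxE; exact: scalar_component q0 _.
by move: hxU; rewrite hxE r0 scale0r unitr0.
Qed.

End SpinConnected.

Lemma positive_norm_component (R : realType) n (x : Cl R n) :
  (3 <= n)%N -> even_clifford x -> 0 < spinor_norm x -> clifford_component x.
Proof. by case: n x => [|[|[|m]]] // x _; exact: even_clifford_connected. Qed.

(** * The Levi component and the positive semigroup *)

Section LeviComponent.
Variables (R : realType) (n : nat) (e : 'rV[R]_n).
Hypothesis he : qform e = 1.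
Local Notation Cl := (Cl R n).
Local Notation E := (clv e).
Implicit Types (x : Cl) (g : 'M[Cl]_2).

Lemma levi_mx1 : levi_mx e 1 = 1%:M.
Proof.
rewrite /levi_mx (sigma1 he) invr1 [RHS]mx2E.
by rewrite !mxE.
Qed.

Lemma L_Theta0_levi g : L_Theta0 e g ->
  exists x, [/\ even_clifford x, 0 < spinor_norm x & g = levi_mx e x].
Proof.
move=> gL; have [x xG gE] := L_Theta_levi he (connected_component_sub gL).
exists x; split=> //; apply: component_norm_gt0.
(* The upper left entries of the elements of [L_Theta0] form a connected subset of the Clifford
   group that contains 1. *)
exists ((fun h : 'M[Cl]_2 => h 0 0) @` L_Theta0 e); last by exists g; rewrite // gE mxE.
have L1 : L_Theta0 e 1%:M.
  apply: connected_component_refl; rewrite -levi_mx1.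
  exact/(levi_L_Theta he)/even_clifford1.
split; first by exists 1%:M => //; rewrite mxE.
  move=> _ [h /connected_component_sub /(L_Theta_levi he)[y yG ->] <-].
  by rewrite mxE.
apply: connected_continuous_connected; first exact: component_connected.
by apply: continuous_subspaceT; exact: entry_continuous.
Qed.

Lemma component_L_Theta0 x : clifford_component x -> L_Theta0 e (levi_mx e x).
Proof.
move=> xC; exists (levi_mx e @` (@clifford_component R n)); last by exists x.
split.
- by exists 1; [exact: clifford_component1 | exact: levi_mx1].
- move=> _ [y /component_even_clifford yG <-]; exact: levi_L_Theta.
(* On the component [levi_mx] agrees with [f], where the only inverse is that of the norm, a
   nonvanishing real function. *)
pose f x : 'M[Cl]_2 := mx2 x 0 0 ((spinor_norm x)^-1 *: (E * x * E)).
have -> : levi_mx e @` (@clifford_component R n) = f @` (@clifford_component R n).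
  apply/seteqP; split=> _ [y yC <-]; exists y => //;
  by rewrite /levi_mx (sigma_invE he) //; exact: component_even_clifford.
apply: connected_continuous_connected; first exact: component_connected.
apply: continuous_in_subspaceT => y /set_mem yC.
have y0 : spinor_norm y != 0 by rewrite gt_eqF // component_norm_gt0.
apply: (@entrywise_cvg Cl) => i j; rewrite mxE.
under eq_fun do rewrite mxE.
case: ifP => _; case: ifP => _.
- exact: cvg_id.
- exact: cl_cst_cvg.
- exact: cl_cst_cvg.
apply: (@clZ_cvg R n Cl (fun y => (spinor_norm y)^-1) (fun y => E * y * E) y).
  by apply: (@inv_spinor_norm_cvg R n Cl id y) => //; exact: cvg_id.
apply: (@clM_cvg R n Cl (fun y => E * y) (fun=> E) y); last exact: cl_cst_cvg.
by apply: (@clM_cvg R n Cl (fun=> E) id y); [exact: cl_cst_cvg | exact: cvg_id].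
Qed.

End LeviComponent.

(** * Products of positive Gauss decompositions *)

Section PositiveSemigroup.
Variables (R : realType) (n : nat) (e : 'rV[R]_n).
Hypothesis he : qform e = 1.
Local Notation Cl := (Cl R n).
Local Notation E := (clv e).
Local Notation sigma := (sigma_e e).
Implicit Types (a x y z : Cl) (g h : 'M[Cl]_2) (s : seq 'M[Cl]_2).

Lemma positive_twist x y : even_clifford x -> eVpos e y ->
  eVpos e ((sigma x)^-1 * y * x^-1).
Proof.
move=> xG yP; rewrite -{2}(sigmaK he x) -(sigmaV he (sigma x)).
by apply: (eVpos_twist he) => //; exact/even_cliffordV/even_clifford_sigma.
Qed.

Lemma lower_gauss y' y a z : mx2 1 0 y' 1 *m gauss_mx e y a z = gauss_mx e (y' + y) a z.
Proof.
by rewrite /gauss_mx !mulmxA mx2M !(mul1r, mul0r, mulr1, mulr0, addr0, add0r).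
Qed.

Lemma levi_gauss x y a z : even_clifford x -> even_clifford a ->
  levi_mx e x *m gauss_mx e y a z =
  gauss_mx e ((sigma x)^-1 * y * x^-1) (x * a) z.
Proof.
move=> [_ xU _] [_ aU _].
rewrite !gauss_mxE /levi_mx mx2M !mul0r !addr0 !add0r (sigmaM he).
rewrite (invrM (sigma_unit he aU) (sigma_unit he xU)) mulrDr !mulrA.
by rewrite !(mulrVK xU).
Qed.

Lemma upper_gauss0 z' a z : even_clifford a ->
  mx2 1 z' 0 1 *m gauss_mx e 0 a z = gauss_mx e 0 a (z + a^-1 * z' * (sigma a)^-1).
Proof.
move=> [_ aU _]; rewrite !gauss_mxE mx2M !(mul0r, mul1r, mulr0, addr0, add0r).
by rewrite mulrDr !mulrA mulrV // mul1r.
Qed.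

(** With [p = y^-1 + z'] and [q = z'^-1 + y] one has [1 + z' y = p y = z' q]. Moving the upper
    factor past the lower one thus gives the new lower entry [y (p y)^-1 = p^-1] and the upper entry
    [(z' q)^-1 z' = q^-1], which is then twisted by [a]. *)
Lemma upper_gauss z' y a z : even_clifford a -> eVpos e y -> eVpos e z' ->
  mx2 1 z' 0 1 *m gauss_mx e y a z =
  gauss_mx e (y^-1 + z')^-1 ((y^-1 + z') * y * a)
    (z + a^-1 * (z'^-1 + y)^-1 * (sigma a)^-1).
Proof.
move=> [_ aU _] yP zP; have [yU _ _] := eVpos_unit he yP.
have [zU _ _] := eVpos_unit he zP.
have [pU _ _] := eVpos_unit he (eVposD he (eVposV he yP) zP).
have [qU _ _] := eVpos_unit he (eVposD he (eVposV he zP) yP).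
set p := y^-1 + z' in pU *; set q := z'^-1 + y in qU *.
have pE : p * y = 1 + z' * y by rewrite mulrDl mulVr.
have pq : p * y = z' * q by rewrite mulrDr mulrV.
have pzs : p * y * a * (a^-1 * q^-1 * (sigma a)^-1) = z' * (sigma a)^-1.
  by rewrite !mulrA (mulrK aU) pq (mulrK qU).
have pV : eVpos e p by exact: eVposD (eVposV he yP) zP.
have sp : sigma (p * y) = y * p.
  by rewrite (sigmaM he) (eV_fixed he (eVpos_eV pV)) (eV_fixed he (eVpos_eV yP)).
have pyU : p * y \is a GRing.unit by rewrite unitrMl.
rewrite !gauss_mxE mx2M !mul1r !mul0r !add0r; congr mx2.
- by rewrite pE mulrDl mul1r mulrA.
- by rewrite [in RHS]mulrDr pzs pE mulrDl mul1r mulrDr !mulrDl !mulrA addrA.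
- by rewrite !mulrA mulVr // mul1r.
- have saU : sigma a \is a GRing.unit by exact: sigma_unit.
  have ypU : y * p \is a GRing.unit by rewrite unitrMl.
  have T1 : p^-1 * (p * y * a) * z = y * a * z by rewrite !mulrA mulVr // mul1r.
  have T2 : p^-1 * (p * y * a) * (a^-1 * q^-1 * (sigma a)^-1) =
      p^-1 * z' * (sigma a)^-1 by rewrite -mulrA pzs mulrA.
  have T3 : (sigma (p * y * a))^-1 = p^-1 * y^-1 * (sigma a)^-1.
    by rewrite (sigmaM he (p * y) a) sp (invrM saU ypU) (invrM yU pU).
  rewrite [in RHS]mulrDr T1 T2 T3 -addrA -mulrDl -mulrDr [z' + _]addrC.
  by rewrite (mulVr pU) mul1r.
Qed.

Lemma positive_gauss_semigroup y a z : L_Theta0 e (levi_mx e a) -> eVpos e y -> eVpos e z ->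
  Spin2n_pos e (gauss_mx e y a z).
Proof.
move=> aL yP zP; exists [:: mx2 1 0 y 1; levi_mx e a; mx2 1 z 0 1]; split.
- move=> h; rewrite !inE => /or3P[] /eqP ->; first by left; right; exists y.
    by right.
  by left; left; exists z.
- by exists (mx2 1 z 0 1); [rewrite !inE eqxx !orbT | exists z].
- by exists (mx2 1 0 y 1); [rewrite !inE eqxx | exists y].
by rewrite /= mulmx1 mulmxA.
Qed.

(* P will say that a unipotent factor of the kind of z occurs in the product. *)
Definition semipositive (P : Prop) z : Prop := (z = 0 \/ eVpos e z) /\ (P -> eVpos e z).

(** Factors are added on the left. Both coordinates start at 0; a unipotent factor makes the
    coordinate of its kind positive, and every further factor keeps it so. *)
Lemma semigroup_gauss s :
  {in s, forall h, (U_Theta_pos e `|` U_Theta_opp_pos e `|` L_Theta0 e) h} ->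
  exists y a z, [/\ even_clifford a, 0 < spinor_norm a,
    semipositive (exists2 h, h \in s & U_Theta_opp_pos e h) y,
    semipositive (exists2 h, h \in s & U_Theta_pos e h) z
    & foldr mulmx 1%:M s = gauss_mx e y a z].
Proof.
(* The off-diagonal entries tell the kinds of generators apart: a unipotent one has exactly one of
   them zero, the other being a unit. *)
have off h : (U_Theta_pos e h -> h 1 0 = 0 /\ h 0 1 \is a GRing.unit) /\
    (U_Theta_opp_pos e h -> h 0 1 = 0 /\ h 1 0 \is a GRing.unit).
  by split=> -[z zP <-]; rewrite !mxE; have [] := eVpos_unit he zP.
elim: s => [|h s IHs] sG.
  exists 0, 1, 0; split; [exact: even_clifford1 | by rewrite spinor_norm1 | | |].
  - by split; [left|case].
  - by split; [left|case].
  - by rewrite -[LHS](levi_mx1 he) gauss_mxE /levi_mx !(mulr0, mul0r, add0r).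
have [|y [a [z [aG a0 [y0 yP] [z0 zP] sE]]]] := IHs; first by move=> k ks; apply: sG; rewrite inE ks orbT.
have memC (U : set 'M[Cl]_2) : ~ U h -> (exists2 k, k \in h :: s & U k) ->
    exists2 k, k \in s & U k.
  by move=> hU [k]; rewrite inE => /orP[/eqP ->//|ks kU]; exists k.
rewrite /= sE; have [[hU|hU]|hL] := sG h (mem_head _ _).
- have [h10 h01] := (off h).1 hU.
  have hV : ~ U_Theta_opp_pos e h by move=> /(off h).2[h01']; rewrite h01' unitr0 in h01.
  have [z' z'P hE] := hU; have [_ z'G z'0] := eVpos_unit he z'P.
  have zD w : eVpos e w -> eVpos e (z + w).
    by move=> wP; case: z0 => [->|zp]; [rewrite add0r | exact: eVposD].
  have twist w : eVpos e w -> eVpos e (a^-1 * w * (sigma a)^-1).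
    by move=> wP; rewrite -(sigmaV he); exact: (eVpos_twist he (even_cliffordV aG) wP).
  (* When [y = 0] the new upper factor only has to cross the Levi factor. *)
  case: y0 => [yE|yp].
    exists 0, a, (z + a^-1 * z' * (sigma a)^-1).
    split; [exact: aG | exact: a0 | | |].
    + by split; [left | move=> /(memC _ hV)/yP; rewrite yE].
    + by split=> [|_]; [right|]; apply/zD/twist.
    + by rewrite -hE yE; exact: upper_gauss0.
  have pP := eVposD he (eVposV he yp) z'P; have qP := eVposD he (eVposV he z'P) yp.
  have [_ pG p0] := eVpos_unit he pP; have [_ yG yn0] := eVpos_unit he yp.
  exists (y^-1 + z')^-1, ((y^-1 + z') * y * a),
    (z + a^-1 * (z'^-1 + y)^-1 * (sigma a)^-1); split.
  + by apply: even_cliffordM => //; exact: even_cliffordM.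
  + rewrite spinor_normM //; last exact: even_cliffordM.
    by rewrite spinor_normM // !mulr_gt0.
  + by split=> [|_]; [right|]; exact: eVposV.
  + by split=> [|_]; [right|]; apply/zD/twist/eVposV.
  + by rewrite -hE; exact: upper_gauss.
- have [h01 h10] := (off h).2 hU.
  have hV : ~ U_Theta_pos e h by move=> /(off h).1[h10']; rewrite h10' unitr0 in h10.
  have [y' y'P hE] := hU; have yD : eVpos e (y' + y).
    by case: y0 => [->|yp]; [rewrite addr0 | exact: eVposD].
  exists (y' + y), a, z; split; [exact: aG | exact: a0 | | |].
  + by split=> //; right.
  + by split=> // /(memC _ hV)/zP.
  + by rewrite -hE; exact: lower_gauss.
have [x [xG x0 hE]] := L_Theta0_levi he hL.
have hV : ~ U_Theta_pos e h by move=> /(off h).1[_]; rewrite hE mxE unitr0.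
have hV' : ~ U_Theta_opp_pos e h by move=> /(off h).2[_]; rewrite hE mxE unitr0.
exists ((sigma x)^-1 * y * x^-1), (x * a), z; split.
- exact: even_cliffordM.
- by rewrite spinor_normM // mulr_gt0.
- split; last by move=> /(memC _ hV')/yP; exact: positive_twist.
  by case: y0 => [->|yp]; [left; rewrite mulr0 mul0r | right; exact: positive_twist].
- by split=> // /(memC _ hV)/zP.
- by rewrite hE; exact: levi_gauss.
Qed.

Lemma semigroup_positive_gauss g : Spin2n_pos e g ->
  exists y a z, positive_triple e y a z /\ g = gauss_mx e y a z.
Proof.
move=> [s [sG sU sV ->]]; have [y [a [z [aG a0 [_ yP] [_ zP] ->]]]] := semigroup_gauss sG.
by exists y, a, z; split=> //; split=> //; [exact: yP | exact: zP].
Qed.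

End PositiveSemigroup.

Theorem proposition2p15 (R : realType) (n : nat) (e : 'rV[R]_n)
    (he : qform e = 1) :
  (exists2 O : set 'M[Cl R n]_2, open O &
     parameterizes (point_mx e)
       [set phi | [/\ Cl_point e phi, normalized phi & even_arcs phi]]
       (O `&` Spin2n e)) /\
  ((3 <= n)%N ->
     parameterizes (point_mx e)
       [set phi | [/\ positive_point e phi, normalized phi & even_arcs phi]]
       (Spin2n_pos e)).
Proof.
split.
  (* The entries of the matrix of a point are the images of the arcs 13, 14, 23 and 24, which are
     units. *)
  exists [set g : 'M[Cl R n]_2 | forall i j, g i j \is a GRing.unit].
    exact: unit_entries_open.
  split=> [phi psi [phiP phi1 phie] [psiP psi1 psie]|]; first exact: point_mx_inj.
  apply/seteqP; split=> [_ [phi [phiP phi1 phie] <-]|g [gU gS]].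
    have G := point_even_clifford phiP phie.
    have [_ U13 _] := G p1 p3 isT; have [_ U14 _] := G p1 p4 isT.
    have [_ U23 _] := G p2 p3 isT; have [_ U24 _] := G p2 p4 isT.
    have [[aG [yV _] [zV _] _] gE _] := point_gauss he phiP phi1 phie.
    split; last by rewrite gE; exact: gauss_Spin2n.
    move=> i j; rewrite (point_mxE he phiP phi1 phie) mxE.
    by case: ifP => _; case: ifP.
  have [|||||y [z [yaz gE]]] := @Spin2n_gauss _ _ _ he (g 0 0) (g 0 1) (g 1 0) (g 1 1) => //.
    by rewrite -mx2E.
  have [phi [phiP phi1 phie phiE _]] := gauss_point he yaz.
  by exists phi => //; rewrite phiE -gE -mx2E.
move=> n3; split=> [phi psi [[phiP _ _] phi1 phie] [[psiP _ _] psi1 psie]|].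
  exact: point_mx_inj.
apply/seteqP; split=> [_ [phi [phip phi1 phie] <-]|g].
  have [phiP _ _] := phip.
  have [_ gE /(_ phip)[aG a0 yP zP]] := point_gauss he phiP phi1 phie.
  rewrite gE; apply: positive_gauss_semigroup => //.
  (* Connectedness for [n >= 3] places the Levi factor, whose norm is positive, in [L_Theta0]. *)
  by apply: (component_L_Theta0 he); exact: positive_norm_component.
move=> /(semigroup_positive_gauss he)[y [a [z [yaz ->]]]].
have [phi [phiP phi1 phie phiE phip]] := gauss_point he (positive_triple_gauss he yaz).
by exists phi => //; split=> //; exact: phip.
Qed.
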